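(* The space $C(\omega^\omega)$ admits all possible spreading models, both the conditional and the unconditional ones. That is, if $X$ is a Banach space with a spreading Schauder basis $(x_i)_i$, then there exists a sequence $(y_i)_i$ in $C(\omega^\omega)$ that generates a spreading model equivalent to $(x_i)_i$.
   Context: Banach spaces are real. $C(\omega^\omega)$ is the space of continuous real functions, with the supremum norm, on the compact ordinal interval $[0,\omega^\omega]$ with the order topology. Two sequences are equivalent if the norms of their finite linear combinations with the same coefficients are comparable up to uniform positive constants. A sequence is spreading if it is equivalent to all of its subsequences; it is unconditional or conditional (i.e. not unconditional). A bounded sequence $(y_i)_i$ in a Banach space generates a sequence $(e_i)_i$ in a semi-normed space as a spreading model if for any $n\in\mathbb{N}$, $\varepsilon>0$ (and coefficients in a bounded set, say $a_1,\dots,a_n\in[-1,1]$) there is $n_0\in\mathbb{N}$ such that for any $n_0\leqslant k_1<\cdots<k_n$ and all such $a_1,\ldots,a_n$, $$\Big|\Big\|\sum_{i=1}^na_iy_{k_i}\Big\|-\Big\|\sum_{i=1}^na_ie_i\Big\|\Big|<\varepsilon.$$ *)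

(* Defs.v *)
From HB Require Import structures.
From mathcomp Require Import all_boot all_order all_algebra.
From mathcomp Require Import all_classical all_reals.
From mathcomp Require Import topology normedtype sequences.
From mathcomp Require Import lra.

Set Implicit Arguments.
Unset Strict Implicit.
Unset Printing Implicit Defensive.
Import Order.TTheory GRing.Theory Num.Theory.
Import numFieldNormedType.Exports.
Local Open Scope classical_set_scope.
Local Open Scope ring_scope.

(* An ordinal below omega^omega is encoded by its Cantor normal form          *)
(* omega^n * c_n + ... + omega^1 * c_1 + c_0, stored as \sum_i c_i *: 'X^i in *)
(* {poly nat}.                                                                *)
Variant ordWW : Type := CNF of {poly nat} | omega_omega.

HB.instance Definition _ := gen_eqMixin ordWW.
HB.instance Definition _ := gen_choiceMixin ordWW.

Definition ltWW (x y : ordWW) : bool :=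
  match x, y with
  | CNF p, CNF q =>
      `[< exists i : nat, ((p`_i)%R < (q`_i)%R)%N /\
            forall j : nat, (i < j)%N -> p`_j = q`_j >]
  | CNF _, omega_omega => true
  | omega_omega, _ => false
  end.

Lemma ltWW_irr : irreflexive ltWW.
Proof.
by case=> [p|] //=; apply/asboolP => -[i []]; rewrite ltnn.
Qed.

Lemma ltWW_trans : transitive ltWW.
Proof.
move=> [q|] [p|] [r|] //= /asboolP[i [pqi pq]] /asboolP[j [qrj qr]].
apply/asboolP; case: (ltngtP i j) => [ij|ji|ij].
- exists j; split=> [|k jk]; first by rewrite pq.
  by rewrite pq ?qr// (ltn_trans ij).
- exists i; split=> [|k ik]; first by rewrite -qr.
  by rewrite pq ?qr// (ltn_trans ji).
- rewrite -ij in qrj qr; exists i; split=> [|k ik]; first exact: ltn_trans qrj.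
  by rewrite pq ?qr.
Qed.

HB.instance Definition _ :=
  Order.Lt_isPOrder.Build Order.default_display ordWW ltWW_irr ltWW_trans.

Lemma ltWWE (x y : ordWW) : (x < y)%O = ltWW x y. Proof. by []. Qed.

Lemma ltWW_total (x y : ordWW) : x != y -> ltWW x y || ltWW y x.
Proof.
case: x y => [p|] [q|] //= pq; last by rewrite eqxx in pq.
have {}pq : p != q by apply: contra pq => /eqP ->.
pose N := maxn (size p) (size q).
have [j pqj] : exists j, p`_j != q`_j.
  apply/not_existsP => pqE; move/eqP: pq; apply; apply/polyP => i.
  by apply/eqP; apply/negPn/negP; exact: pqE.
have bnd i : p`_i != q`_i -> (i <= N)%N.
  apply: contraNT; rewrite -ltnNge => Ni.
  by rewrite !nth_default// ltnW// (leq_ltn_trans _ Ni)// ?leq_maxl ?leq_maxr.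
case: (ex_maxnP (ex_intro (fun j => p`_j != q`_j) j pqj) bnd) => i pqi imax.
have eqi k : (i < k)%N -> p`_k = q`_k.
  by move=> ik; apply/eqP; apply: contraLR ik => /imax; rewrite -leqNgt.
case: (ltngtP (p`_i)%R (q`_i)%R) => [lt|gt|/eqP]; last by rewrite (negPf pqi).
  by apply/orP; left; apply/asboolP; exists i.
by apply/orP; right; apply/asboolP; exists i; split=> // k /eqi.
Qed.

Lemma leWW_total : total (<=%O : rel ordWW).
Proof.
move=> x y; have [->|xy] := eqVneq x y; first by rewrite lexx.
by have := ltWW_total xy; rewrite -!ltWWE => /orP[] /ltW ->; rewrite ?orbT.
Qed.

HB.instance Definition _ :=
  Order.POrder_isTotal.Build Order.default_display ordWW leWW_total.

Lemma nat_min (A : set nat) : A !=set0 ->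
  exists2 m, A m & forall n, A n -> (m <= n)%N.
Proof.
move=> [a Aa]; have exA : exists n, `[< A n >] by exists a; exact/asboolP.
exists (ex_minn exA); case: ex_minnP => m /asboolP// Am min n An.
by apply: min; exact/asboolP.
Qed.

Lemma ordWW_wf (A : set ordWW) : A !=set0 ->
  exists2 m, A m & forall x, A x -> (m <= x)%O.
Proof.
move=> [x0 Ax0]; pose B := [set p : {poly nat} | A (CNF p)].
have wfn n (C : set {poly nat}) : C !=set0 ->
    (forall p q, C p -> C q -> forall j, (n <= j)%N -> p`_j = q`_j) ->
    exists2 m, C m & forall p, C p -> (CNF m <= CNF p :> ordWW)%O.
  elim: n C => [|n IH] C [p0 Cp0] Cn.
    exists p0 => // p Cp; rewrite (_ : p = p0)//.
    by apply/polyP => i; exact: Cn.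
  have [c [p1 Cp1 p1c] cmin] : exists2 m, [set p`_n | p in C] m &
      forall k, [set p`_n | p in C] k -> (m <= k)%N.
    by apply: nat_min; exists p0`_n; exists p0.
  have [||m [Cm mc] mmin] := IH [set p | C p /\ p`_n = c].
  - by exists p1.
  - move=> p q [Cp pc] [Cq qc] j; rewrite leq_eqVlt => /predU1P[<-|nj].
      by rewrite pc qc.
    exact: Cn.
  exists m => // p Cp; have [pc|pc] := eqVneq p`_n c; first exact: mmin.
  apply/ltW; rewrite ltWWE/=; apply/asboolP; exists n; split.
    by rewrite mc ltn_neqAle eq_sym pc cmin//; exists p.
  by move=> j nj; exact: Cn.
have [[p0 Bp0]|B0] := pselect (B !=set0); last first.
  exists x0 => // -[p Ap|_]; first by case: B0; exists p.
  by case: x0 Ax0 => [p Ap|_]; [apply/ltW; rewrite ltWWE|exact: lexx].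
have [s [p1 Bp1 p1s] smin] : exists2 m, [set size p | p in B] m &
    forall k, [set size p | p in B] k -> (m <= k)%N.
  by apply: nat_min; exists (size p0); exists p0.
have [||m [Bm ms] mmin] := wfn s [set p | B p /\ size p = s].
- by exists p1.
- by move=> p q [_ ps] [_ qs] j sj; rewrite !nth_default ?ps ?qs.
exists (CNF m) => // -[p Bp|_]; last by apply/ltW; rewrite ltWWE.
have [ps|ps] := eqVneq (size p) s; first exact: mmin.
have sp : (s < size p)%N by rewrite ltn_neqAle eq_sym ps smin//; exists p.
have p_gt0 : (0 < size p)%N by exact: leq_ltn_trans sp.
apply/ltW; rewrite ltWWE/=; apply/asboolP; exists (size p).-1; split.
  rewrite [X in (X < _)%N]nth_default; last by rewrite ms -ltnS prednK.
  by rewrite lt0n -lead_coefE lead_coef_eq0 -size_poly_gt0.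
move=> j; rewrite -ltnS prednK// ltnS => pj.
by rewrite !nth_default// ms (leq_trans (ltnW sp)).
Qed.

(* The compact ordinal interval [0, omega^omega] with its order topology.     *)
Definition ordinal_itvWW : orderTopologicalType Order.default_display :=
  order_topology ordWW.

Lemma ordinal_itvWW_compact : compact [set: ordinal_itvWW].
Proof.
move=> F FF _; pose S : set ordWW := [set x | forall B, F B ->
  exists2 b : ordWW, B b & (b <= x)%O].
have [|m Sm mmin] := @ordWW_wf S.
  exists omega_omega => B /filter_ex[b Bb]; exists b => //.
  by case: b {Bb} => [p|]; [apply/ltW; rewrite ltWWE|exact: lexx].
have nC l : (l < m)%O -> exists2 C, F C & forall b : ordWW, C b -> (l < b)%O.
  move=> lm; have : ~ S l by move=> /mmin; rewrite leNgt lm.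
  move=> /existsNP[C /not_implyP[FC /forall2NP nCl]]; exists C => // b Cb.
  by have [//|/negP] := nCl b; rewrite -ltNge.
exists m; split=> // B U FB.
rewrite (@itv_nbhsE _ ordinal_itvWW m) => -[i [oi mi] iU].
suff [C FC Ci] : exists2 C, F C & forall b : ordWW, C b -> (b <= m)%O -> b \in i.
  have [b [Bb Cb] bm] := Sm _ (filterI FB FC).
  by exists b; split=> //; apply: iU; exact: Ci.
case: i oi mi {iU} => -[[] l|[]] [[] r|[]] //= _; rewrite !in_itv/= ?andbT => mi.
- case/andP: mi => lm mr.
  have [C FC Cl] := nC l lm; exists C => // b Cb bm.
  by rewrite in_itv/= Cl//= (le_lt_trans bm).
- have [C FC Cl] := nC l mi; exists C => // b Cb bm.
  by rewrite in_itv/= Cl.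
- exists setT; first exact: filterT.
  by move=> b _ bm; rewrite in_itv/= (le_lt_trans bm).
- by exists setT; first exact: filterT.
Qed.

Section continuous_functions.
Variables (K : topologicalType) (K_compact : compact [set: K]) (R : realType).

(* The space C(K) of a compact space K: pointwise operations, sup norm. The   *)
(* phantom argument K_compact is what makes the supremum a norm.              *)
Definition Cspace : Type := (fun=> continuousType K R) K_compact.

HB.instance Definition _ := Choice.copy Cspace (continuousType K R).

Definition Cfun (f : Cspace) : K -> R := (f : continuousType K R).

Lemma Cfun_continuous (f : Cspace) : continuous (Cfun f).
Proof. exact: cts_fun. Qed.

Definition Cmk (f : K -> R) (cf : continuous f) : Cspace :=
  mkcts cf : continuousType K R.

Lemma CmkE (f : K -> R) (cf : continuous f) : Cfun (Cmk cf) = f.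
Proof. by []. Qed.

Lemma CspaceP (f g : Cspace) : Cfun f =1 Cfun g -> f = g.
Proof. by move=> fg; apply/continuousEP. Qed.

Lemma CaddP (f g : Cspace) : continuous (fun t => Cfun f t + Cfun g t).
Proof. by move=> t; apply: cvgD; exact: Cfun_continuous. Qed.

Lemma CoppP (f : Cspace) : continuous (fun t => - Cfun f t).
Proof. by move=> t; apply: cvgN; exact: Cfun_continuous. Qed.

Lemma CscaleP (a : R) (f : Cspace) : continuous (fun t => a * Cfun f t).
Proof. by move=> t; apply: cvgMr; exact: Cfun_continuous. Qed.

Lemma CzeroP : continuous (fun _ : K => 0 : R).
Proof. by move=> t; exact: cvg_cst. Qed.

Arguments CaddP f g : clear implicits.
Arguments CoppP f : clear implicits.
Arguments CscaleP a f : clear implicits.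
Arguments CzeroP : clear implicits.

Lemma CaddA : associative (fun f g => Cmk (CaddP f g)).
Proof. by move=> f g h; apply: CspaceP => t; rewrite !CmkE addrA. Qed.
Lemma CaddC : commutative (fun f g => Cmk (CaddP f g)).
Proof. by move=> f g; apply: CspaceP => t; rewrite !CmkE addrC. Qed.
Lemma Cadd0 : left_id (Cmk CzeroP) (fun f g => Cmk (CaddP f g)).
Proof. by move=> f; apply: CspaceP => t; rewrite !CmkE add0r. Qed.
Lemma CaddN :
  left_inverse (Cmk CzeroP) (fun f => Cmk (CoppP f)) (fun f g => Cmk (CaddP f g)).
Proof. by move=> f; apply: CspaceP => t; rewrite !CmkE addNr. Qed.

HB.instance Definition _ :=
  GRing.isZmodule.Build Cspace CaddA CaddC Cadd0 CaddN.

Lemma CscaleA (a b : R) (f : Cspace) :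
  Cmk (CscaleP a (Cmk (CscaleP b f))) = Cmk (CscaleP (a * b) f).
Proof. by apply: CspaceP => t; rewrite !CmkE mulrA. Qed.
Lemma Cscale1 : left_id 1 (fun a f => Cmk (CscaleP a f)).
Proof. by move=> f; apply: CspaceP => t; rewrite !CmkE mul1r. Qed.
Lemma CscaleDr : right_distributive (fun a f => Cmk (CscaleP a f)) +%R.
Proof. by move=> a f g; apply: CspaceP => t; rewrite !CmkE mulrDr. Qed.
Lemma CscaleDl (f : Cspace) :
  {morph (fun a => Cmk (CscaleP a f)) : a b / a + b}.
Proof. by move=> a b; apply: CspaceP => t; rewrite !CmkE mulrDl. Qed.

HB.instance Definition _ :=
  GRing.Zmodule_isLmodule.Build R Cspace CscaleA Cscale1 CscaleDr CscaleDl.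

Lemma CfunD (f g : Cspace) t : Cfun (f + g) t = Cfun f t + Cfun g t.
Proof. by []. Qed.
Lemma CfunN (f : Cspace) t : Cfun (- f) t = - Cfun f t.
Proof. by []. Qed.
Lemma CfunZ (a : R) (f : Cspace) t : Cfun (a *: f) t = a * Cfun f t.
Proof. by []. Qed.

Definition supnorm (f : Cspace) : R := sup [set `|Cfun f t| | t in [set: K]].

Lemma Cfun_ubound (f : Cspace) : has_ubound [set `|Cfun f t| | t in [set: K]].
Proof.
have : compact (Cfun f @` [set: K]).
  apply: continuous_compact => //; apply: continuous_subspaceT.
  exact: Cfun_continuous.
move=> /compact_bounded[M [_ Mf]]; exists (M + 1) => _ [t _ <-].
by apply: (Mf (M + 1)); [rewrite ltrDl|exists t].
Qed.

Lemma ler_supnorm (f : Cspace) t : `|Cfun f t| <= supnorm f.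
Proof. by apply: ub_le_sup; [exact: Cfun_ubound|exists t]. Qed.

Lemma supnorm_le (f : Cspace) (M : R) :
  0 <= M -> (forall t, `|Cfun f t| <= M) -> supnorm f <= M.
Proof.
move=> M0 fM; have [[t tK]|K0] := pselect ([set: K] !=set0).
  by apply: ge_sup; [exists `|Cfun f t|; exists t|move=> _ [s _ <-]; exact: fM].
rewrite /supnorm (_ : [set _ | _ in _] = set0) ?sup0//.
by apply/seteqP; split=> // x [t _ _]; case: K0; exists t.
Qed.

Lemma supnorm_ge0 (f : Cspace) : 0 <= supnorm f.
Proof.
have [[t tK]|K0] := pselect ([set: K] !=set0).
  by rewrite (le_trans _ (ler_supnorm f t)).
rewrite /supnorm (_ : [set _ | _ in _] = set0) ?sup0//.
by apply/seteqP; split=> // x [t _ _]; case: K0; exists t.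
Qed.

Lemma ler_supnormD (f g : Cspace) : supnorm (f + g) <= supnorm f + supnorm g.
Proof.
apply: supnorm_le => [|t]; first by rewrite addr_ge0 ?supnorm_ge0.
by rewrite CfunD (le_trans (ler_normD _ _))// lerD ?ler_supnorm.
Qed.

Lemma supnormZ (a : R) (f : Cspace) : supnorm (a *: f) = `|a| * supnorm f.
Proof.
have leZ b g : supnorm (b *: g) <= `|b| * supnorm g.
  apply: supnorm_le => [|t]; first by rewrite mulr_ge0 ?supnorm_ge0.
  by rewrite CfunZ normrM ler_wpM2l ?ler_supnorm.
apply/eqP; rewrite eq_le leZ/=; have [->|a0] := eqVneq a 0.
  by rewrite normr0 mul0r supnorm_ge0.
rewrite -ler_pdivlMl ?normr_gt0// -normfV.
by have := leZ a^-1 (a *: f); rewrite scalerA mulVf// scale1r.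
Qed.

Lemma supnorm0_eq0 (f : Cspace) : supnorm f = 0 -> f = 0.
Proof.
move=> f0; apply: CspaceP => t; change (Cfun f t = 0).
by apply/eqP; rewrite -normr_le0 -f0 ler_supnorm.
Qed.

HB.instance Definition _ :=
  Lmodule_isNormed.Build R Cspace ler_supnormD supnormZ supnorm0_eq0.

Lemma CnormE (f : Cspace) : `|f| = supnorm f. Proof. by []. Qed.

Lemma tri3 (e a b c d : R) : `|a - b| <= e / 3 -> `|c - b| <= e / 3 ->
  `|c - d| <= e / 3 -> `|a - d| <= e.
Proof. by rewrite !ler_norml; lra. Qed.

Lemma Cspace_complete (F : set_system Cspace) :
  ProperFilter F -> cauchy F -> cvg F.
Proof.
move=> FF /cauchyP Fc.
pose g t : R := lim (Cfun^~ t @ F).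
have gP t : Cfun^~ t @ F --> g t.
  apply: cauchy_cvg; apply/cauchyP => e e0.
  have [f Ff] := Fc e e0; exists (Cfun f t).
  change (F (Cfun^~ t @^-1` ball (Cfun f t) e)).
  apply: filterS Ff => h; rewrite -!ball_normE/=; apply: le_lt_trans.
  exact: ler_supnorm (f - h) t.
have gU (e : R) : 0 < e -> \forall f \near F, forall t, `|g t - Cfun f t| <= e.
  move=> e0; have e3 : 0 < e / 3 by rewrite divr_gt0.
  have [f Ff] := Fc _ e3; apply: (filterS _ Ff) => h fh t.
  have gk : \forall k \near F, `|g t - Cfun k t| <= e / 3.
    by move/cvgrPdist_le : (gP t); apply.
  have [k [fk {}gk]] := filter_ex (filterI Ff gk).
  move: fh fk; rewrite -!ball_normE/= => /ltW fh /ltW fk.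
  have {}fh := le_trans (ler_supnorm (f - h) t) fh.
  have {}fk := le_trans (ler_supnorm (f - k) t) fk.
  move: fh fk; rewrite !CfunD !CfunN => fh fk.
  exact: tri3 gk fk fh.
have gC : continuous g.
  move=> t; apply/cvgrPdist_le => e e0.
  have e3 : 0 < e / 3 by rewrite divr_gt0.
  have [f fg] := filter_ex (gU _ e3).
  have : \forall s \near t, `|Cfun f t - Cfun f s| <= e / 3.
    by move/cvgrPdist_le : (@Cfun_continuous f t); apply.
  apply: filterS => s fs.
  rewrite distrC in fs; have := fg s; rewrite distrC; exact: tri3 (fg t) fs.
apply/cvg_ex; exists (Cmk gC); apply/cvgrPdist_le => e e0.
apply: filterS (gU e e0) => f fg; apply: supnorm_le => //; exact: ltW.
Qed.

HB.instance Definition _ := Uniform_isComplete.Build Cspace Cspace_complete.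
End continuous_functions.

Definition C_omega_omega (R : realType) : completeNormedModType R :=
  Cspace ordinal_itvWW_compact R.

Definition is_seminorm (R : realType) (V : lmodType R) (p : V -> R) : Prop :=
  (forall x y, p (x + y) <= p x + p y) /\
  (forall (a : R) x, p (a *: x) = `|a| * p x).

(* A semi-normed space is given as a module V together with a seminorm on V,  *)
(* which need not separate points; a normed space is the case p = Num.norm.   *)
Definition equivalent_seq (R : realType) (V W : lmodType R)
    (p : V -> R) (q : W -> R) (x : nat -> V) (y : nat -> W) : Prop :=
  exists c C : R, [/\ 0 < c, 0 < C & forall (n : nat) (a : 'I_n -> R),
    c * p (\sum_(i < n) a i *: x i) <= q (\sum_(i < n) a i *: y i) /\
    q (\sum_(i < n) a i *: y i) <= C * p (\sum_(i < n) a i *: x i)].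

Definition spreading (R : realType) (X : normedModType R) (x : nat -> X)
    : Prop :=
  forall k : nat -> nat, {homo k : i j / (i < j)%N} ->
    equivalent_seq (Num.norm : X -> R) (Num.norm : X -> R) x (x \o k).

Definition schauder_basis (R : realType) (X : completeNormedModType R)
    (x : nat -> X) : Prop :=
  forall v : X, exists! a : nat -> R, series (fun i => a i *: x i) @ \oo --> v.

Definition generates_spreading_model (R : realType)
    (Y : completeNormedModType R) (y : nat -> Y)
    (E : lmodType R) (q : E -> R) (e : nat -> E) : Prop :=
  [/\ bounded_fun y, is_seminorm q &
   forall (n : nat) (eps : R), 0 < eps ->
   exists n0 : nat, forall k : 'I_n -> nat,
     (forall i, (n0 <= k i)%N) -> {homo k : i j / (i < j)%N} ->
   forall a : 'I_n -> R, (forall i, -1 <= a i <= 1) ->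
     `| `|\sum_(i < n) a i *: y (k i)| - q (\sum_(i < n) a i *: e i) | < eps].

(* Main.v *)
Require Import Defs.
From HB Require Import structures.
From mathcomp Require Import all_boot all_order all_algebra.
From mathcomp Require Import all_classical all_reals.
From mathcomp Require Import topology normedtype sequences.
From mathcomp Require Import zify ring lra.

(* A set A = {k_0 < k_1 < ...} with at most N elements cuts nat into points   *)
(* and gaps, and a function h on these pieces gives a function i |-> h(piece  *)
(* of i).  The sets A form a copy of omega^N + 1, and for fixed i the value   *)
(* is locally constant in A, so a sequence of functions h, the d-th one being *)
(* placed on blocks of [0, omega^omega] of every degree N, yields continuous  *)
(* functions y_i provided they vanish on a block when i is small.             *)
(* A norming h comes from spreading out (x_i): send the points to x_p for p   *)
(* far apart, and each gap to the mean of x over a long interval between      *)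
(* them.  Shifting a cluster inside a gap changes the mean by little, so a    *)
(* sum of a_j x_j is sent to an average of spreads of itself, whence          *)
(*   | \sum_j a_j h(piece of k_j) | <= K | \sum_j a_j x_j |                   *)
(* for all A, with K the uniform spreading constant; unconditionality plays   *)
(* no role.  The value of h on the initial gap must be 0 for continuity at    *)
(* omega^omega.  Subtracting it costs a factor 2, because                     *)
(* a |-> h(initial gap) * \sum_j a_j is itself bounded; what is lost is put   *)
(* back by a constant value of all y_i at one isolated point.                 *)

(** The model lives on [{poly R}], with basis ['X^i]. Its seminorm [model_norm] is the supremum of
    |sum a_j h(2j + 1)| over the [admissible] h, together with |sum a_j| times [initial_weight]. The
    pattern bounds and [norming_pattern] make it equivalent to the norm of sum a_j x_j
    ([model_norm_equivalent]). For every increasing k, the norm of sum a_j y_(k_j) is at most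
    [model_norm]: each point of the interval other than 0 and omega^omega reads the k_j through a
    pattern, and by [fill] an admissible h read through a pattern is an admissible function read at
    the points ([model_pattern_le]). Conversely, if the k_j are large, they are exactly the points
    of some set in the block of a given h ([block_code_realize]). The blocks are countably many, so
    they carry near-maximizers for integer grids of coefficients. For given n and eps one finite
    grid serves all a, which yields n_0 ([model_seq_generates]). *)

Set Implicit Arguments.
Unset Strict Implicit.
Unset Printing Implicit Defensive.
Import Order.TTheory GRing.Theory Num.Theory.
Import numFieldNormedType.Exports.
Local Open Scope classical_set_scope.
Local Open Scope ring_scope.

(** * Pieces of a finite set of integers *)

(* The piece number 2r is the gap before the r-th point, and 2r + 1 is the    *)
(* r-th point.  [precedes c c'] says that c and c' can be the pieces of some  *)
(* i < i': only gaps may be repeated.                                         *)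
Definition precedes (c c' : nat) : bool := (c + odd c <= c')%N.

Definition pattern n (pi : 'I_n -> nat) : Prop :=
  forall i j : 'I_n, (i < j)%N -> precedes (pi i) (pi j).

(* The piece of i for the set c_0 < c_0 + 1 + c_1 < ..., where e = c_0, c_1,  *)
(* ... lists the successive lengths of the gaps.                              *)
Fixpoint locate (e : seq nat) (i : nat) : nat :=
  if e is c :: e' then
    if (i < c)%N then 0 else if i == c then 1 else (locate e' (i - c.+1)).+2
  else 0.

Lemma precedesSS c c' : precedes c.+2 c'.+2 = precedes c c'.
Proof. by rewrite /precedes /= negbK !addSn !ltnS. Qed.

Lemma locate_precedes e i j : (i < j)%N -> precedes (locate e i) (locate e j).
Proof.
elim: e i j => [//|c e IH] i j ij /=.
case: (ltnP i c) => ic; first by rewrite /precedes.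
have -> : (j < c)%N = false by lia.
have -> : (j == c) = false by lia.
case: eqP => // ic'.
by rewrite precedesSS; apply: IH; lia.
Qed.

(** This is the source of continuity: points added after a gap longer than i are invisible from
    i. *)
Lemma locate_cat e c e' i : (i < c)%N -> locate (e ++ c :: e') i = locate e i.
Proof.
elim: e i => [|b e IH] i ic /=; first by rewrite ic.
by rewrite IH//; lia.
Qed.

Fixpoint gaps (b : nat) (ks : seq nat) : seq nat :=
  if ks is k :: ks' then (k - b)%N :: gaps k.+1 ks' else [::].

Lemma locate_gaps b ks j : path leq b ks -> sorted ltn ks -> (j < size ks)%N ->
  locate (gaps b ks) (nth 0 ks j - b) = j.*2.+1.
Proof.
elim: ks b j => [//|k ks IH] b [|j] /= /andP[bk _] kks.
  by move=> _; rewrite ltnn eqxx.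
rewrite ltnS => jks.
have kj : (k < nth 0 ks j)%N.
  by move: kks => /(order_path_min ltn_trans)/allP/(_ _ (mem_nth 0%N jks)).
have -> : (nth 0 ks j - b < k - b)%N = false by lia.
have -> : (nth 0 ks j - b == k - b)%N = false by lia.
have -> : (nth 0 ks j - b - (k - b).+1 = nth 0 ks j - k.+1)%N by lia.
rewrite IH ?doubleS//; last exact: path_sorted kks.
case: ks kks {IH jks kj} => //= k' ks /andP[-> kk] /=.
by apply: sub_path kk => ? ?; exact: ltnW.
Qed.

Lemma size_gaps b ks : size (gaps b ks) = size ks.
Proof. by elim: ks b => //= k ks IH b; rewrite IH. Qed.

(* Extends a pattern, read as a map on the points, to all the pieces: a gap   *)
(* goes to the first gap after all previous values.  Hence any pattern is     *)
(* realized by the set of all the k_j, up to replacing h by h \o fill pi.     *)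
Definition fill n (pi : 'I_n -> nat) (c : nat) : nat :=
  if [pick j : 'I_n | c == j.*2.+1] is Some j then pi j
  else \max_(j < n | (j.*2.+1 < c)%N) (pi j + odd (pi j)).

Lemma fill_odd n (pi : 'I_n -> nat) (j : 'I_n) : fill pi j.*2.+1 = pi j.
Proof.
rewrite /fill; case: pickP => [i /eqP ij|/(_ j)]; last by rewrite eqxx.
by congr pi; apply: val_inj => /=; lia.
Qed.

Lemma fill0 n (pi : 'I_n -> nat) : fill pi 0 = 0%N.
Proof. by rewrite /fill; case: pickP => //= _; rewrite big_pred0. Qed.

(** All the terms are even, so the maximum is a gap, which may be repeated. *)
Lemma precedes_max n (P : pred 'I_n) (pi : 'I_n -> nat) c :
  precedes (\max_(j < n | P j) (pi j + odd (pi j))) c =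
  (\max_(j < n | P j) (pi j + odd (pi j)) <= c)%N.
Proof.
rewrite /precedes; set m := \max_(_ < _ | _) _.
suff -> : odd m = false by rewrite addn0.
apply: (big_ind (fun m => odd m = false)) => // [x y ox oy|i _].
  by rewrite /maxn; case: ifP.
by rewrite oddD oddb addbb.
Qed.

Lemma fill_precedes n (pi : 'I_n -> nat) c c' : pattern pi ->
  precedes c c' -> precedes (fill pi c) (fill pi c').
Proof.
move=> ppi cc'; rewrite /fill.
case: pickP => [j /eqP cj|cj]; case: pickP => [j' /eqP cj'|cj'].
- by apply: ppi; move: cc'; rewrite cj cj' /precedes /=; lia.
- apply: (leq_bigmax_cond (F := fun j => (pi j + odd (pi j))%N)).
  by move: cc'; rewrite cj /precedes /=; lia.
- rewrite precedes_max; apply/bigmax_leqP => i ic; apply: ppi.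
  by move: cc'; rewrite cj' /precedes /=; lia.
- rewrite precedes_max; apply/bigmax_leqP => i ic.
  apply: (leq_bigmax_cond (F := fun j => (pi j + odd (pi j))%N)).
  by move: cc'; rewrite /precedes; lia.
Qed.

(** * Uniformity of the spreading constant *)

Lemma sum_reindex (R : realType) (V : lmodType R) (z : nat -> V) n p
    (b : 'I_n -> R) (k : 'I_n -> nat) : (forall i, (k i < p)%N) ->
  \sum_(j < p) (\sum_(i < n | k i == j) b i) *: z j = \sum_(i < n) b i *: z (k i).
Proof.
move=> kp; under eq_bigr do rewrite scaler_suml.
rewrite (exchange_big_dep xpredT)//=; apply: eq_bigr => i _.
by rewrite (big_pred1 (Ordinal (kp i)))//= => j; rewrite -val_eqE /= eq_sym.
Qed.

Section uniform_spreading.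
Variables (R : realType) (X : normedModType R) (x : nat -> X).

Definition comparable (K : R) n (k : nat -> nat) : Prop :=
  forall b : nat -> R,
    `|\sum_(i < n) b i *: x (k i)| <= K * `|\sum_(i < n) b i *: x i| /\
    `|\sum_(i < n) b i *: x i| <= K * `|\sum_(i < n) b i *: x (k i)|.

Lemma comparable_le K K' n k : K <= K' -> comparable K n k -> comparable K' n k.
Proof.
by move=> KK' c b; have [c1 c2] := c b; split;
  [apply: (le_trans c1)|apply: (le_trans c2)]; rewrite ler_wpM2r.
Qed.

Lemma eq_comparable K n k k' : (forall i, (i < n)%N -> k i = k' i) ->
  comparable K n k -> comparable K n k'.
Proof.
move=> kk' c b; have := c b.
suff -> : \sum_(i < n) b i *: x (k i) = \sum_(i < n) b i *: x (k' i) by [].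
by apply: eq_bigr => i _; rewrite kk'.
Qed.

Lemma spreading_comparable k : spreading x -> {homo k : i j / (i < j)%N} ->
  exists2 K : R, 0 < K & forall n, comparable K n k.
Proof.
move=> sx ik; have [c [C [c0 C0 cC]]] := sx _ ik.
exists (C + c^-1) => [|n b]; first by rewrite addr_gt0 ?invr_gt0.
have [h1 h2] := cC n (fun i => b i); split.
  by apply: (le_trans h2); rewrite ler_wpM2r// lerDl invr_ge0 ltW.
move: h1; rewrite -ler_pdivlMl// => /le_trans; apply.
by rewrite ler_wpM2r// lerDr ltW.
Qed.

(* A violation of comparability can be moved beyond any initial segment of k, *)
(* because both x and its values on a final segment are equivalent to shifts. *)
Lemma comparable_splice : spreading x ->
  (forall K, exists n k, {homo k : i j / (i < j)%N} /\ ~ comparable K n k) ->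
  forall (k : nat -> nat) N (K : R), {homo k : i j / (i < j)%N} -> 0 <= K ->
  exists k' N', [/\ {homo k' : i j / (i < j)%N}, (N < N')%N,
    forall i, (i < N)%N -> k' i = k i & ~ comparable K N' k'].
Proof.
move=> sx bad k N K ik K0.
have ishift M : {homo addn M : i j / (i < j)%N} by move=> i j; rewrite ltn_add2l.
have [K1 K10 c1] := spreading_comparable sx (ishift N).
have [K2 K20 c2] := spreading_comparable sx (ishift (k N)).
(* K1 pays for shifting the indices of x by N, K2 for shifting the values of l by [k N]. *)
have [n [l [il nl]]] := bad (K1 * K2 * K).
have n0 : (0 < n)%N.
  by rewrite lt0n; apply: contra_notN nl => /eqP -> b; rewrite !big_ord0 normr0 mulr0.
pose k' i := if (i < N)%N then k i else (k N + l (i - N))%N.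
exists k', (N + n)%N; split.
- move=> i j ij; rewrite /k'; case: (ltnP i N) => iN; case: (ltnP j N) => jN.
  + exact: ik.
  + by rewrite (leq_trans (ik _ _ iN))// leq_addr.
  + by lia.
  + by rewrite ltn_add2l; apply: il; lia.
- by lia.
- by move=> i iN; rewrite /k' iN.
apply: contra_not nl => c b.
pose b' i := if (i < N)%N then 0 else b (i - N)%N.
have sumN (z : nat -> X) :
    \sum_(i < N + n) b' i *: z i = \sum_(i < n) b i *: z (N + i)%N.
  rewrite big_split_ord /= big1 ?add0r => [|i _].
    by apply: eq_bigr => i _; rewrite /b' ltnNge leq_addr/= addKn.
  by rewrite /b' ltn_ord scale0r.
have [h1 h2] := c b'; rewrite !(sumN (x \o k')) !(sumN x) /= in h1 h2.
have k'E i : k' (N + i)%N = (k N + l i)%N by rewrite /k' ltnNge leq_addr/= addKn.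
have E : \sum_(i < n) b i *: x (k' (N + i)%N) = \sum_(i < n) b i *: x (k N + l i)%N.
  by apply: eq_bigr => i _; rewrite k'E.
rewrite E in h1 h2.
have [h3 h4] := c1 n b.
have lP (i : 'I_n) : (l i < l n)%N by exact: il.
have [h5 h6] := c2 (l n) (fun j => \sum_(i < n | l i == j) b i).
move: h5 h6; rewrite (sum_reindex (x \o addn (k N)) b lP)/= (sum_reindex x b lP).
move=> h5 h6; split.
- apply: (le_trans h6); rewrite -!mulrA [K1 * _]mulrCA ler_wpM2l ?(ltW K20)//.
  by apply: (le_trans h1); rewrite [K1 * _]mulrCA ler_wpM2l.
- apply: (le_trans h4); rewrite -!mulrA ler_wpM2l ?(ltW K10)//.
  by apply: (le_trans h2); rewrite [K2 * _]mulrCA ler_wpM2l.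
Qed.

(** Gliding hump: otherwise splicing produces sequences that violate the constants 0, 1, 2, ... on
    longer and longer initial segments, each keeping the segment of the one before. Their limit is a
    single subsequence that admits no constant at all. *)
Lemma spreading_uniform : spreading x -> exists2 K : R, 1 <= K &
  forall n (k : nat -> nat), {homo k : i j / (i < j)%N} -> comparable K n k.
Proof.
move=> sx; have [[K cK]|nK] := pselect (exists K : R,
  forall n (k : nat -> nat), {homo k : i j / (i < j)%N} -> comparable K n k).
  exists (Num.max 1 K) => [|n k ik]; first by rewrite le_max lexx.
  by apply: comparable_le (cK n k ik); rewrite le_max lexx orbT.
exfalso.
have bad K : exists n k, {homo k : i j / (i < j)%N} /\ ~ comparable K n k.
  apply: contra_notP nK => nK; exists K => n k ik; apply: contrapT => nc.
  by apply: nK; exists n, k.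
have /choice[f fP] : forall s : (nat -> nat) * nat * nat,
    exists s' : (nat -> nat) * nat, {homo s.1.1 : i j / (i < j)%N} ->
      [/\ {homo s'.1 : i j / (i < j)%N}, (s.1.2 < s'.2)%N,
      forall i, (i < s.1.2)%N -> s'.1 i = s.1.1 i
      & ~ comparable s.2%:R s'.2 s'.1].
  move=> [[k N] m]/=; have [ik|nik] := pselect {homo k : i j / (i < j)%N}.
    have [k' [N' kN']] := comparable_splice sx bad N ik (ler0n R m).
    by exists (k', N').
  by exists (k, N) => /nik.
pose S := fix S m := if m is m'.+1 then f (S m', m') else (id, 0%N).
have Si m : {homo (S m).1 : i j / (i < j)%N}.
  by elim: m => [//|m IH]; have [] := fP (S m, m) IH.
have SN m : ((S m).2 < (S m.+1).2)%N by have [] := fP (S m, m) (Si m).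
have SE m i : (i < (S m).2)%N -> (S m.+1).1 i = (S m).1 i.
  by have [_ _ + _] := fP (S m, m) (Si m); apply.
have Sbad m : ~ comparable m%:R (S m.+1).2 (S m.+1).1.
  by have [] := fP (S m, m) (Si m).
have SNle m d : ((S m).2 <= (S (m + d)%N).2)%N.
  by elim: d => [|d IH]; rewrite ?addn0// addnS (leq_trans IH)// ltnW.
have SElt m d i : (i < (S m).2)%N -> (S (m + d)%N).1 i = (S m).1 i.
  move=> im; elim: d => [|d IH]; rewrite ?addn0// addnS SE//.
  exact: leq_trans (SNle _ _).
have SNm m : (m <= (S m).2)%N.
  by elim: m => // m IH; exact: leq_ltn_trans (SN m).
pose k i := (S i.+1).1 i.
have kE m i : (i < (S m).2)%N -> k i = (S m).1 i.
  move=> im; rewrite /k; case: (leqP i.+1 m) => h.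
    by rewrite -(subnKC h) SElt//; exact: (SNm i.+1).
  by rewrite -(subnKC (ltnW h)) SElt.
have ik : {homo k : i j / (i < j)%N}.
  move=> i j ij; rewrite (@kE j.+1 i); last exact: leq_trans (leqW ij) (SNm _).
  by apply: Si.
have [K K0 cK] := spreading_comparable sx ik.
have [m Km] : exists m, K <= m%:R.
  by exists (Num.truncn K).+1; exact/ltW/truncnS_gt.
apply: (Sbad m); apply: eq_comparable (comparable_le Km (cK _)).
exact: kE.
Qed.

Lemma spreading_ord : spreading x -> exists2 K : R, 1 <= K &
  forall n (k : 'I_n -> nat), {homo k : i j / (i < j)%N} ->
  forall a : 'I_n -> R,
    `|\sum_(i < n) a i *: x (k i)| <= K * `|\sum_(i < n) a i *: x i| /\
    `|\sum_(i < n) a i *: x i| <= K * `|\sum_(i < n) a i *: x (k i)|.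
Proof.
move=> /spreading_uniform[K K1 cK]; exists K => // -[|n] k ik a.
  by rewrite !big_ord0 normr0 mulr0.
pose k' i := if (i <= n)%N then k (inord i) else (k ord_max + i)%N.
have ik' : {homo k' : i j / (i < j)%N}.
  move=> i j ij; rewrite /k'; case: (leqP i n) => iN; case: (leqP j n) => jN.
  - by apply: ik; rewrite !inordK.
  - suff : (k (inord i) <= k ord_max)%N by lia.
    have [->|ni] := eqVneq i n.
      by rewrite (_ : inord n = ord_max)//; apply: val_inj; rewrite /= inordK.
    by apply/ltnW/ik; rewrite inordK//= ltn_neqAle ni.
  - by lia.
  - by rewrite ltn_add2l.
have := cK n.+1 k' ik' (fun i => a (inord i)).
have E (z : nat -> X) (l : 'I_n.+1 -> nat) : \sum_(i < n.+1) a (inord i) *: z (l i) =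
   \sum_(i < n.+1) a i *: z (l i).
  by apply: eq_bigr => i _; rewrite inord_val.
rewrite (E x (fun i => i)) (E x (fun i => k' i)).
suff -> : \sum_(i < n.+1) a i *: x (k' i) = \sum_(i < n.+1) a i *: x (k i) by [].
by apply: eq_bigr => i _; rewrite /k' -ltnS ltn_ord inord_val.
Qed.

End uniform_spreading.

(** * Norming functionals on a sequence *)

Section hahn_banach.
Variables (R : realType) (X : normedModType R).

(** One step of Hahn-Banach, with [G] the graph of the functional built so far. The value c at z is
    the supremum of the lower constraints r - |v - z|; the triangle inequality keeps it below the
    upper ones. *)
Lemma dominated_extension (G : X -> R -> Prop) (z : X) :
  G 0 0 ->
  (forall v w r s, G v r -> G w s -> G (v + w) (r + s)) ->
  (forall t v r, G v r -> G (t *: v) (t * r)) ->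
  (forall v r, G v r -> r <= `|v|) ->
  exists c, forall v r s, G v r -> r + s * c <= `|v + s *: z|.
Proof.
move=> G0 GD GZ Gp.
pose B := [set y | exists v r, G v r /\ y = r - `|v - z|].
have Bub w s : G w s -> ubound B (`|w + z| - s).
  move=> Gw _ [v [r [Gv ->]]].
  have h : r + s <= `|v + w| by apply: Gp; exact: GD.
  have h2 : `|v + w| <= `|v - z| + `|w + z|.
    by rewrite (_ : v + w = (v - z) + (w + z)) ?ler_normD// addrACA addNr addr0.
  by lra.
have Bsup : has_sup B.
  split; last by exists (`|0 + z| - 0); exact: Bub.
  by exists (0 - `|0 - z|), 0, 0.
exists (sup B) => v r s Gv.
have [s0|s0|->] := ltrgtP s 0; last by rewrite mul0r scale0r !addr0; exact: Gp.
- have t0 : 0 < - s by rewrite oppr_gt0.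
  have : (- s)^-1 * r - `|(- s)^-1 *: v - z| <= sup B.
    apply: ub_le_sup; first by case: Bsup.
    by exists ((- s)^-1 *: v), ((- s)^-1 * r); split=> //; exact: GZ.
  have -> : (- s)^-1 *: v - z = (- s)^-1 *: (v + s *: z).
    by rewrite scalerDr scalerA invrN mulNr mulVf ?lt_eqF// scaleN1r.
  rewrite normrZ gtr0_norm ?invr_gt0// -mulrBr ler_pdivrMl//; lra.
- have : sup B <= `|s^-1 *: v + z| - s^-1 * r.
    by apply: ge_sup; [case: Bsup|apply: Bub; exact: GZ].
  have -> : s^-1 *: v + z = s^-1 *: (v + s *: z).
    by rewrite scalerDr scalerA mulVf ?gt_eqF// scale1r.
  rewrite normrZ gtr0_norm ?invr_gt0// -mulrBr ler_pdivlMl//; lra.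
Qed.

(* Hahn-Banach along a sequence; [t *: u] makes the functional norm u. *)
Lemma norming_coefficients (z : nat -> X) (u : X) : exists c : nat -> R,
  forall n (a : nat -> R) t, t * `|u| + \sum_(i < n) a i * c i <=
    `|t *: u + \sum_(i < n) a i *: z i|.
Proof.
pose good n (c : nat -> R) := forall (a : nat -> R) t,
  t * `|u| + \sum_(i < n) a i * c i <= `|t *: u + \sum_(i < n) a i *: z i|.
have good_eq n c c' : (forall i, (i < n)%N -> c i = c' i) -> good n c -> good n c'.
  move=> cc' gc a t; rewrite (le_trans _ (gc a t))// lerD2l.
  by rewrite le_eqVlt; apply/orP; left; apply/eqP/eq_bigr => i _; rewrite cc'.
have ext n c : good n c -> exists r, good n.+1 (fun i => if i == n then r else c i).
  move=> gc; pose G v r := exists (a : nat -> R) t,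
    v = t *: u + \sum_(i < n) a i *: z i /\ r = t * `|u| + \sum_(i < n) a i * c i.
  have [|||v _ [a [t [-> ->]]]|r rP] := @dominated_extension G (z n).
  - exists (fun=> 0), 0; rewrite !big1 => [|i _|i _]; rewrite ?scale0r ?mul0r ?addr0//.
  - move=> _ _ _ _ [a [t [-> ->]]] [b [s [-> ->]]].
    exists (fun i => a i + b i), (t + s).
    rewrite scalerDl mulrDl addrACA [X in _ /\ X = _]addrACA -!big_split/=.
    by split; congr (_ + _); apply: eq_bigr => i _; rewrite ?scalerDl ?mulrDl.
  - move=> s _ _ [a [t [-> ->]]]; exists (fun i => s * a i), (s * t).
    rewrite scalerDr mulrDr scalerA mulrA scaler_sumr mulr_sumr.
    by split; congr (_ + _); apply: eq_bigr => i _; rewrite ?scalerA ?mulrA.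
  - exact: gc.
  exists r => a t; rewrite !big_ord_recr/= eqxx !addrA.
  apply: (rP _ _ (a n)); exists a, t; split=> //; congr (_ + _).
  by apply: eq_bigr => i _; rewrite ltn_eqF.
have /choice[f fP] : forall s : nat * (nat -> R), exists r, good s.1 s.2 ->
    good s.1.+1 (fun i => if i == s.1 then r else s.2 i).
  move=> [n c]/=; have [/ext[r rP]|nc] := pselect (good n c); first by exists r.
  by exists 0.
pose S := fix S n : nat -> R :=
  if n is m.+1 then fun i => if i == m then f (m, S m) else S m i else fun=> 0.
have Sgood n : good n (S n).
  elim: n => [|n IH]; last by have := fP (n, S n) IH.
  move=> a t; rewrite !big_ord0 !addr0 normrZ.
  by rewrite ler_wpM2r// ler_norm.
have SE n d i : (i < n)%N -> S (n + d)%N i = S n i.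
  move=> iN; elim: d => [|d IH]; rewrite ?addn0// addnS/= ltn_eqF//.
  by rewrite ltn_addr.
exists (fun i => S i.+1 i) => n.
suff : good n (fun i => S i.+1 i) by [].
apply: good_eq (Sgood n) => i iN.
by rewrite -(subnKC iN) SE.
Qed.

End hahn_banach.

Lemma ultra_bounded_cvg (R : realType) (T : Type) (F : set_system T) (f : T -> R)
    (B : R) : UltraFilter F -> (forall i, `|f i| <= B) ->
  exists l : R, f @ F --> l.
Proof.
move=> FU fB; have [|l [_ lc]] := @segment_compact R (- B) B (f @ F) _.
  by apply: (@filterE _ F) => i /=; rewrite in_itv/= -ler_norml.
exists l => V Vl; have [//|nV] := in_ultra_setVsetC (f @^-1` V) FU.
by have [y [nVy Vy]] := lc (~` V) V nV Vl.
Qed.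

Lemma cvg_sumZ (R : realType) (T : Type) (F : set_system T) (n : nat)
    (a : 'I_n -> R) (f : 'I_n -> T -> R) (l : 'I_n -> R) : Filter F ->
  (forall j, f j @ F --> l j) ->
  (fun i => \sum_(j < n) a j * f j i) @ F --> \sum_(j < n) a j * l j.
Proof.
move=> FF fl; apply: (@cvg_big _ _ _ _ _ (@add_continuous _)) => // j _.
by apply: cvgMr; exact: fl.
Qed.

(** Each shift by one replaces one term of the sum, at a cost of at most 2B. *)
Lemma sum_shift_le (R : realType) (g : nat -> R) (B : R) w j :
  (forall i, `|g i| <= B) ->
  `|\sum_(m < w) g m - \sum_(m < w) g (m + j)%N| <= j%:R * (2 * B).
Proof.
move=> gB; elim: j => [|j IH].
  by under [X in _ - X]eq_bigr do rewrite addn0; rewrite subrr normr0 mul0r.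
have -> : \sum_(m < w) g m - \sum_(m < w) g (m + j.+1)%N =
    (\sum_(m < w) g m - \sum_(m < w) g (m + j)%N) - (g (w + j)%N - g j).
  have -> : g (w + j)%N - g j = \sum_(m < w) (g (m.+1 + j)%N - g (m + j)%N).
    by rewrite -(big_mkord xpredT (fun m => g (m.+1 + j)%N - g (m + j)%N))
      (@telescope_sumr _ 0 w (fun m => g (m + j)%N)).
  have -> : \sum_(m < w) g (m + j.+1)%N = \sum_(m < w) g (m.+1 + j)%N.
    by apply: eq_bigr => m _; rewrite addnS addSn.
  by rewrite sumrB; ring.
rewrite -natr1 mulrDl mul1r (le_trans (ler_normB _ _))// lerD//.
by rewrite (le_trans (ler_normB _ _))// mulr2n mulrDl mul1r lerD.
Qed.

Section norming_patterns.
Variables (R : realType) (X : normedModType R) (x : nat -> X).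

Lemma norming_sequence n (a : 'I_n -> R) (k : 'I_n -> nat) : exists f : nat -> R,
  (forall m (b : 'I_m -> R) (l : 'I_m -> nat),
    `|\sum_(i < m) b i * f (l i)| <= `|\sum_(i < m) b i *: x (l i)|) /\
  `|\sum_(i < n) a i *: x (k i)| <= \sum_(i < n) a i * f (k i).
Proof.
set u := \sum_(i < n) _.
have [f fP] := norming_coefficients x u.
have fQ t m (b : 'I_m -> R) (l : 'I_m -> nat) :
    t * `|u| + \sum_(i < m) b i * f (l i) <=
    `|t *: u + \sum_(i < m) b i *: x (l i)|.
  have := fP (\max_i l i).+1 (fun j => \sum_(i < m | l i == j) b i) t.
  have lP i : (l i < (\max_i l i).+1)%N by rewrite ltnS leq_bigmax.
  by have := @sum_reindex R R^o f _ _ b l lP; rewrite (sum_reindex x b lP) => ->.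
exists f; split=> [m b l|].
  rewrite ler_norml -[- _ <= _]subr_ge0 opprK; apply/andP; split.
    have := fQ 0 m (fun i => - b i) l.
    under eq_bigr do rewrite mulNr; under [X in _ <= `|_ + X|]eq_bigr do rewrite scaleNr.
    by rewrite !sumrN mul0r scale0r !add0r normrN lerNl -subr_ge0 opprK addrC.
  by have := fQ 0 m b l; rewrite mul0r scale0r !add0r.
(* With t = 1 and coefficients -a the right side is |u - u| = 0, which forces f to norm u. *)
have := fQ 1 n (fun i => - a i) k.
under eq_bigr do rewrite mulNr; under [X in _ <= `|_ + X|]eq_bigr do rewrite scaleNr.
by rewrite !sumrN scale1r mul1r -/u subrr normr0 subr_le0.
Qed.

Variable K : R.
Hypothesis K_ge1 : 1 <= K.
Hypothesis K_spreading : forall n (k : 'I_n -> nat), {homo k : i j / (i < j)%N} ->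
  forall a : 'I_n -> R,
    `|\sum_(i < n) a i *: x (k i)| <= K * `|\sum_(i < n) a i *: x i| /\
    `|\sum_(i < n) a i *: x i| <= K * `|\sum_(i < n) a i *: x (k i)|.

Lemma spreading_bound i : `|x i| <= K * `|x 0%N|.
Proof.
have [|+ _] := @K_spreading 1 (fun=> i) _ (fun=> 1).
  by move=> j j'; rewrite !ord1.
by rewrite !big_ord1 !scale1r.
Qed.

Definition pattern_bounded (C : R) (h : nat -> R) : Prop :=
  forall n (pi : 'I_n -> nat) (a : 'I_n -> R), pattern pi ->
    `|\sum_(j < n) a j * h (pi j)| <= C * `|\sum_(j < n) a j *: x j|.

(* The piece c owns the window [2wc, 2w(c + 1)[, which leaves room for all    *)
(* the shifts by m < w of a cluster of at most w integers.                    *)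
Definition window_mean (w : nat) (f : nat -> R) (c : nat) : R :=
  if odd c then f (w.*2 * c)%N
  else w%:R^-1 * \sum_(m < w) f (w.*2 * c + m)%N.

(** For each m < w, moving the clusters inside the gaps by m gives an increasing sequence, since a
    pattern repeats no point and m + j stays below the window length 2w. Averaging over m keeps the
    bound K. Replacing this average by the window mean shifts the j-th term by j, an error of order
    1/w. *)
Lemma window_mean_pattern w f n (pi : 'I_n -> nat) (a : 'I_n -> R) :
  (forall m (b : 'I_m -> R) (l : 'I_m -> nat),
    `|\sum_(i < m) b i * f (l i)| <= `|\sum_(i < m) b i *: x (l i)|) ->
  (0 < w)%N -> (n <= w)%N -> pattern pi ->
  `|\sum_(j < n) a j * window_mean w f (pi j)| <=
    K * `|\sum_(j < n) a j *: x j| +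
    w%:R^-1 * \sum_(j < n) `|a j| * (n%:R * (2 * (K * `|x 0%N|))).
Proof.
move=> fx w0 nw ppi.
have K0 : 0 <= K by exact: le_trans K_ge1.
have w0' : (w%:R : R) != 0 by rewrite pnatr_eq0 -lt0n.
have fB i : `|f i| <= K * `|x 0%N|.
  have := fx 1%N (fun=> 1) (fun=> i); rewrite !big_ord1 mul1r scale1r.
  by move=> /le_trans; apply; exact: spreading_bound.
pose k (m : nat) (j : 'I_n) := (w.*2 * pi j + (if odd (pi j) then 0 else m + j))%N.
have ik (m : 'I_w) : {homo k m : i j / (i < j)%N}.
  move=> i j ij; rewrite /k; have := ppi i j ij; rewrite /precedes.
  have := ltn_ord i; have := ltn_ord j; have := ltn_ord m.
  move=> mw jn iN pij.
  have [e|ne] := eqVneq (pi i) (pi j).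
    move: pij; rewrite e; case: (odd (pi j)) => /=; move: (w.*2 * pi j)%N => u; lia.
  have lt : (pi i < pi j)%N by lia.
  have : (w.*2 * pi i + w.*2 <= w.*2 * pi j)%N by rewrite -mulnSr leq_mul.
  case: (odd (pi i)); case: (odd (pi j)) => /=;
    by move: (w.*2 * pi i)%N (w.*2 * pi j)%N => u v; lia.
(* S is the mean over m of the functional f on the spreads of the a_j x_j. *)
pose S := w%:R^-1 * \sum_(m < w) \sum_(j < n) a j * f (k m j).
have Sle : `|S| <= K * `|\sum_(j < n) a j *: x j|.
  rewrite normrM ger0_norm ?invr_ge0// ler_pdivrMl ?ltr0n//.
  rewrite (le_trans (ler_norm_sum _ _ _))// mulr_natl -[X in _ *+ X]card_ord.
  rewrite -sumr_const; apply: ler_sum => m _.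
  by rewrite (le_trans (fx _ _ _))//; have [] := K_spreading (ik m) a.
rewrite -(subrK S (\sum_(j < n) _)) addrC (le_trans (ler_normD _ _))// lerD//.
rewrite /S exchange_big/= !mulr_sumr -sumrB (le_trans (ler_norm_sum _ _ _))//.
apply: ler_sum => j _.
rewrite -mulr_sumr mulrCA -mulrBr normrM mulrCA ler_wpM2l//.
rewrite /window_mean /k; case: ifP => oj.
  rewrite (eq_bigr (fun=> f (w.*2 * pi j)%N)) => [|m _]; last by rewrite addn0.
  rewrite sumr_const card_ord -(mulr_natl (f (w.*2 * pi j)%N) w) mulKf//.
  rewrite subrr normr0.
  by rewrite !mulr_ge0 ?invr_ge0.
rewrite -mulrBr normrM ger0_norm ?invr_ge0// ler_wpM2l ?invr_ge0//.
have := @sum_shift_le R (fun m => f (w.*2 * pi j + m)%N) _ w j (fun i => fB _).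
move=> /le_trans; apply.
rewrite ler_wpM2r ?ler_nat ?(ltnW (ltn_ord j))//.
by rewrite !mulr_ge0.
Qed.

(** h is a limit of window means along a free ultrafilter, which exists for all pieces at once and
    removes the error of order 1/w. At the pieces 2j + 1 the means are plain values of f, so norming
    the spread sum survives in the limit. *)
Lemma norming_pattern n (a : 'I_n -> R) : exists h : nat -> R,
  pattern_bounded K h /\
  `|\sum_(j < n) a j *: x j| <= K * `|\sum_(j < n) a j * h (nat_of_ord j).*2.+1|.
Proof.
have /choice[f fP] : forall w : nat, exists f : nat -> R,
  (forall m (b : 'I_m -> R) (l : 'I_m -> nat),
    `|\sum_(i < m) b i * f (l i)| <= `|\sum_(i < m) b i *: x (l i)|) /\
  `|\sum_(i < n) a i *: x (w.+1.*2 * i.*2.+1)%N| <=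
    \sum_(i < n) a i * f (w.+1.*2 * i.*2.+1)%N.
  move=> w; exact: norming_sequence.
have fB w i : `|f w i| <= K * `|x 0%N|.
  have [+ _] := fP w => /(_ 1%N (fun=> 1) (fun=> i)).
  rewrite !big_ord1 mul1r scale1r.
  by move=> /le_trans; apply; exact: spreading_bound.
pose g w c := window_mean w.+1 (f w) c.
have gB w c : `|g w c| <= K * `|x 0%N|.
  rewrite /g /window_mean; case: ifP => // _.
  rewrite normrM ger0_norm ?invr_ge0// ler_pdivrMl ?ltr0n//.
  rewrite (le_trans (ler_norm_sum _ _ _))// mulr_natl -[X in _ *+ X]card_ord.
  by rewrite -sumr_const; exact: ler_sum.
have [U [UU oU]] := ultraFilterLemma (@eventually_filter).
have UP : ProperFilter U by exact: ultra_proper.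
have UF : Filter U by exact: _.
have /choice[h hP] : forall c, exists l : R, g ^~ c @ U --> l.
  by move=> c; apply: (ultra_bounded_cvg UU) => w; exact: gB.
exists h; split.
  move=> m pi b ppi.
  have /cvg_norm hS := @cvg_sumZ R nat U m b _ _ UF (fun j => hP (pi j)).
  apply/ler_addgt0Pr => e e0; apply: (cvgr_to_le hS).
  set D := \sum_(j < m) `|b j| * (m%:R * (2 * (K * `|x 0%N|))).
  apply: oU; near=> w.
  rewrite (le_trans (window_mean_pattern b (fP w).1 _ _ ppi))//.
    near: w; exists m => // w /=; exact: leqW.
  rewrite lerD2l ler_pdivrMl ?ltr0n//.
  rewrite -ler_pdivrMr//; near: w.
  exists (Num.truncn (D / e)).+1 => // w /=.
  move=> /leqW; rewrite -(ler_nat R) => /(le_trans _); apply.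
  exact/ltW/truncnS_gt.
have /cvg_norm hS := @cvg_sumZ R nat U n a _ _ UF (fun j => hP (nat_of_ord j).*2.+1).
suff : K^-1 * `|\sum_(j < n) a j *: x j| <=
  `|\sum_(j < n) a j * h (nat_of_ord j).*2.+1|.
  by rewrite ler_pdivrMl// (lt_le_trans ltr01).
apply: (cvgr_to_ge hS); apply: nearW => w.
rewrite ler_pdivrMl ?(lt_le_trans ltr01)//.
have /K_spreading/(_ a)[_] : {homo (fun i : 'I_n => w.+1.*2 * i.*2.+1)%N : i j / (i < j)%N}.
  by move=> i j ij; rewrite ltn_mul2l/=; lia.
move=> /le_trans; apply; rewrite ler_wpM2l ?(le_trans ler01)//.
rewrite (le_trans (fP w).2)// (le_trans (ler_norm _))//.
rewrite le_eqVlt; apply/orP; left; apply/eqP; congr `|_|; apply: eq_bigr => i _.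
by rewrite /g /window_mean /= odd_double.
Unshelve. all: by end_near.
Qed.

End norming_patterns.

(** * Continuous functions on the ordinal interval *)

(* Lowers the last nonzero digit by 1 and forgets the zeros below it, least   *)
(* significant digit first.  An ordinal omega^k * c is a limit of the         *)
(* omega^k * (c - 1) + beta with beta < omega^k, so these are the digits that *)
(* vary continuously from the left.                                           *)
Fixpoint pred_digits (s : seq nat) : seq nat :=
  match s with
  | [::] => [::]
  | 0%N :: s' => pred_digits s'
  | c.+1 :: s' => c :: s'
  end.

Definition digits (p : {poly nat}) : seq nat := rev (pred_digits p).

(* The leading digit d selects the function h d, the other ones a set of      *)
(* integers, shifted by N + d where N is the degree: thus only finitely many  *)
(* blocks (N, d) lie outside the initial gap at i.                            *)
Definition block_code (p : {poly nat}) (i : nat) : nat :=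
  let b := ((size p).-1 + head 0 (digits p))%N in
  if (i < b)%N then 0%N else locate (behead (digits p)) (i - b).

Lemma pred_digits_nseq l c s : pred_digits (nseq l 0%N ++ c.+1 :: s) = c :: s.
Proof. by elim: l. Qed.

Lemma pred_digits_cat s b t : (1 < b)%N ->
  exists s' b', (b <= b'.+1)%N /\ pred_digits (s ++ b :: t) = s' ++ b' :: t.
Proof.
move=> b1; elim: s => [|[|c] s IH] /=.
- by case: b b1 => [|b]// _; exists [::], b.
- exact: IH.
- by exists (c :: s), b; rewrite leqnSn.
Qed.

Lemma CNF_lt_succ (r p : {poly nat}) :
  (CNF r < CNF (p + 1))%O -> (CNF r <= CNF p)%O.
Proof.
rewrite ltWWE /= => /asboolP[j' [rj' rE]]; rewrite leNgt.
apply/negP; rewrite ltWWE /= => /asboolP[j [pj pE]].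
have p1 i : (p + 1)`_i = ((p`_i)%R + (i == 0))%N.
  by rewrite coefD coef1; case: (i == 0).
rewrite p1 in rj'; case: (ltngtP j j') => jj.
- by move: rj'; rewrite -pE//; case: j' jj {rE} => //= *; lia.
- by move: pj; rewrite rE// p1; case: j jj {pE} => //= *; lia.
- move: rj' pj; rewrite jj; case: j' jj rE => [|j'] jj rE /=; rewrite ?addn0; lia.
Qed.

Lemma CNF_gap (p r a : {poly nat}) l c : p`_l = c.+1 -> a`_l = c ->
  (forall j, (j < l)%N -> p`_j = 0%N) -> (forall j, (l < j)%N -> a`_j = p`_j) ->
  (CNF a < CNF r)%O -> (CNF r < CNF p)%O ->
  exists j, [/\ (j < l)%N, ((a`_j)%R < (r`_j)%R)%N & forall k, (j < k)%N -> a`_k = r`_k].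
Proof.
move=> pl al p0 ap; rewrite !ltWWE /= => /asboolP[j [arj ar]] /asboolP[k [rpk rp]].
exists j; split=> //.
have lk : (l <= k)%N by rewrite leqNgt; apply/negP => /p0 pk; move: rpk; rewrite pk.
rewrite ltnNge; apply/negP => lj.
case: (ltngtP j k) => jk.
- have := ar _ jk; case: (ltngtP l k) lk => // lk _.
    by rewrite ap// => pr; move: rpk; rewrite pr ltnn.
  by rewrite -lk al => cr; move: (leq_ltn_trans lj jk); rewrite lk ltnn.
- have lj' := leq_ltn_trans lk jk.
  by move: arj; rewrite rp// ap// ltnn.
- move: arj rpk; rewrite -jk; case: (ltngtP l j) lj => // lj' _ arj rpk.
    by rewrite ap// in arj; move: (ltn_trans arj rpk); rewrite ltnn.
  by rewrite -lj' al in arj; rewrite -lj' pl in rpk; move: (leq_trans rpk arj); rewrite ltnn.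
Qed.

Lemma block_code_eq (p q : {poly nat}) i d e b t :
  digits p = d :: e -> size p = size q ->
  digits q = (d :: e) ++ b :: t -> (i < b)%N ->
  block_code q i = block_code p i.
Proof.
move=> dp pq dq ib; rewrite /block_code -pq dp dq /=.
by case: ifP => // _; rewrite locate_cat//; exact: leq_ltn_trans (leq_subr _ _) ib.
Qed.

Lemma locally_constant_continuous (K : topologicalType) (R : realType) (f : K -> R) :
  (forall t, \forall s \near t, f s = f t) -> continuous f.
Proof.
by move=> fc t; apply/cvgrPdist_le => e e0; apply: filterS (fc t) => s ->;
  rewrite subrr normr0 ltW.
Qed.

Section block_function.
Variables (R : realType) (h : nat -> nat -> R) (kappa : R).
Hypothesis h0 : forall d, h d 0%N = 0.

Definition block_fun (i : nat) (t : ordWW) : R :=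
  match t with
  | omega_omega => 0
  | CNF p => if p == 0 then kappa else h (head 0%N (digits p)) (block_code p i)
  end.

Lemma block_fun_lt i (p : {poly nat}) : p != 0 ->
  (i < (size p).-1 + head 0%N (digits p))%N -> block_fun i (CNF p) = 0.
Proof. by move=> p0 ip; rewrite /= (negPf p0) /block_code ip. Qed.

Lemma block_fun_left_limit i (p : {poly nat}) : p != 0 ->
  exists2 a : ordWW, (a < CNF p)%O &
    forall t : ordWW, (a < t)%O -> (t <= CNF p)%O -> block_fun i t = block_fun i (CNF p).
Proof.
move=> p0.
have [l [c [s sp]]] : exists l c s, p = nseq l 0%N ++ c.+1 :: s :> seq nat.
  have : (last 1%N p) != 0%N by case: (p) p0 => -[].
  have : (p : seq nat) != [::] by rewrite -size_eq0 size_poly_eq0.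
  elim: (p : seq nat) => // -[|c] s IH _ /=; last by exists 0%N, c, s.
  case: s IH => // a s IH ls; have [|l [c [s' E]]] := IH isT _; first exact: ls.
  by exists l.+1, c, s'; rewrite E.
have coefp j : p`_j = nth 0%N (nseq l 0%N ++ c.+1 :: s) j by rewrite -sp.
have dp : digits p = rcons (rev s) c.
  by rewrite /digits sp pred_digits_nseq rev_cons.
(* An ordinal strictly between A and p has a digit at least i + 2 at position l - 1; it still
   exceeds i if [pred_digits] lowers it by one. For l = 0, A is the predecessor of p. *)
pose A := if l is l'.+1 then nseq l' 0%N ++ i.+2 :: c :: s else c :: s.
have coefa j : (Poly A : {poly nat})`_j = nth 0%N A j by rewrite coef_Poly.
have pl : p`_l = c.+1 by rewrite coefp nth_cat size_nseq ltnn subnn.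
have pj j : (j < l)%N -> p`_j = 0%N.
  by move=> jl; rewrite coefp nth_cat size_nseq jl nth_nseq jl.
have al : (Poly A : {poly nat})`_l = c.
  rewrite coefa /A; case: (l) => //= l'.
  by rewrite nth_cat size_nseq ltnNge leqnSn/= subSnn.
have ap j : (l < j)%N -> (Poly A : {poly nat})`_j = p`_j.
  rewrite coefa coefp /A nth_cat size_nseq => lj; rewrite ltnNge (ltnW lj) /=.
  case: (l) lj => [|l'] lj /=; first by case: j lj.
  rewrite nth_cat size_nseq ltnNge (ltnW (ltnW lj))/=.
  have -> : (j - l' = (j - l'.+2).+2)%N by lia.
  by have -> : (j - l'.+1 = (j - l'.+2).+1)%N by lia.
exists (CNF (Poly A)) => [|[r|] ar]; last by rewrite leNgt.
  by rewrite ltWWE /=; apply/asboolP; exists l; rewrite al pl; split.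
rewrite le_eqVlt => /predU1P[->//|rp].
have [j [jl aj ajE]] := CNF_gap pl al pj ap ar rp.
case: l => [|l'] in sp coefp A coefa pl pj al ap ar jl aj ajE * => //.
have Al' : nth 0%N A l' = i.+2 by rewrite /A nth_cat size_nseq ltnn subnn.
have rl' : (i.+2 <= (r`_l')%R)%N.
  move: jl; rewrite ltnS leq_eqVlt => /predU1P[jl|jl].
    by rewrite -Al' -coefa -jl ltnW.
  by rewrite -ajE// coefa Al'.
pose low := mkseq (nth 0%N r) l'.
have rE k : r`_k = nth 0%N (low ++ r`_l' :: c :: s) k.
  rewrite nth_cat size_mkseq; case: (ltngtP k l') => kl; first by rewrite nth_mkseq.
    rewrite -ajE ?coefa; last exact: leq_ltn_trans kl.
    by rewrite /A nth_cat size_nseq ltnNge (ltnW kl)/=; case: (k - l')%N (subn_gt0 l' k); rewrite kl.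
  by rewrite kl subnn.
have digE t b' s' : pred_digits r = s' ++ b' :: t -> digits r = rev t ++ b' :: rev s'.
  by rewrite /digits => ->; rewrite rev_cat rev_cons cat_rcons.
have r0 : r != 0 by apply: contraTneq rl' => ->; rewrite coef0.
have b1 : (1 < (r`_l')%R)%N by exact: leq_trans rl'.
(* Either r has the degree of p and its digits extend those of p by a gap longer than i, or p =
   omega^l and r has smaller degree with leading digit above i, where the function vanishes. *)
have [lcs|] := boolP (last 1%N (c :: s) != 0%N).
  have rs : r = low ++ r`_l' :: c :: s :> seq nat.
    have {1}-> : r = Poly (low ++ r`_l' :: c :: s).
      by apply/polyP => k; rewrite coef_Poly -rE.
    by rewrite (@PolyK _ 1) ?last_cat.
  have [s' [b' [bb' E]]] := pred_digits_cat low (c :: s) b1.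
  rewrite -rs in E; have dr := digE _ _ _ E.
  have : rev (c :: s) != [::] by rewrite -size_eq0 size_rev.
  rewrite rev_cons in dr *; rewrite -dp in dr *.
  case dpE : (digits p) => [//|d e] _; rewrite dpE in dr.
  rewrite /= (negPf p0) (negPf r0); congr h; first by rewrite dr dpE.
  apply: (block_code_eq dpE _ dr); last by lia.
  by rewrite sp rs !size_cat /= size_nseq size_mkseq; lia.
have lp : last 1%N p != 0%N by case: (p) p0 => -[].
rewrite negbK => lcs.
have [s0 c0] : s = [::] /\ c = 0%N.
  move: lp lcs; rewrite sp last_cat /=; case: (s) => [|? ?] /=; last by move/negPf->.
  by move=> _ /eqP.
rewrite s0 c0 in rE dp.
have rs : r = rcons low (r`_l') :> seq nat.
  have {1}-> : r = Poly (rcons low (r`_l')).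
    apply/polyP => k; rewrite coef_Poly rE -cats1 !nth_cat; case: ifP => // _.
    by case: (k - _)%N => // -[|[|]].
  by rewrite (@PolyK _ 1) ?last_rcons// -lt0n ltnW.
have [s' [b' [bb' E]]] := pred_digits_cat low [::] b1.
rewrite cats1 -rs in E; have dr := digE _ _ _ E.
rewrite block_fun_lt//; last by rewrite dr /=; lia.
by rewrite /= (negPf p0) dp /block_code dp /=; case: ifP => _; rewrite h0.
Qed.

Lemma block_fun_continuous i :
  continuous (block_fun i : ordinal_itvWW -> R).
Proof.
apply: (@locally_constant_continuous ordinal_itvWW) => t.
suff [a [b [/andP[at_ tb] abE]]] : exists a b : option ordWW,
    (if a is Some a then (a < t)%O else true) && (if b is Some b then (t < b)%O else true) /\
    forall s : ordWW, (if a is Some a then (a < s)%O else true) ->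
     (if b is Some b then (s < b)%O else true) -> block_fun i s = block_fun i t.
  rewrite /prop_near1 (@itv_nbhsE _ ordinal_itvWW t).
  exists (Interval (if a is Some a then BRight a else -oo%O)
                   (if b is Some b then BLeft b else +oo%O)).
    split; first by case: (a) => [?|]; case: (b).
    by rewrite in_itv /=; apply/andP; split; [case: (a) at_|case: (b) tb].
  move=> s; rewrite /= in_itv => /andP[as_ sb].
  by apply: abE; [case: (a) as_|case: (b) sb].
case: t => [p|].
  have [->|p0] := eqVneq p 0.
    exists None, (Some (CNF (0 + 1))); split=> /=.
      rewrite ltWWE /=; apply/asboolP; exists 0%N; rewrite coefD coef1 coef0.
      by split=> // -[|j]// _; rewrite coefD coef1 coef0.
    move=> s _; case: s => [r|//] /CNF_lt_succ; rewrite le_eqVlt => /predU1P[[->]//|].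
    by rewrite ltWWE /= => /asboolP[j []]; rewrite coef0.
  have [a ap aE] := block_fun_left_limit i p0.
  exists (Some a), (Some (CNF (p + 1))); split.
    rewrite ap ltWWE /=; apply/asboolP; exists 0%N; rewrite coefD coef1/=.
    split=> [|[|j]// _]; first by rewrite -[X in (X < _)%N]addr0 ltn_add2l.
    by rewrite coefD coef1 addr0.
  move=> [r|//] ar /CNF_lt_succ rp; exact: aE.
(* Above omega^(i + 1) the degree exceeds i, so i lies in the initial gap. *)
exists (Some (CNF 'X^(i.+1))), None; split; first by [].
move=> [r|//] Xr _.
have ir : (i.+1 < size r)%N.
  rewrite ltnNge; apply/negP => ri.
  have rge k : (i.+1 <= k)%N -> r`_k = 0%N by move=> ik; rewrite nth_default// (leq_trans ri).
  move: Xr; rewrite ltWWE /= => /asboolP[j [Xj Xk]].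
  case: (leqP i.+1 j) => ij; first by rewrite rge in Xj.
  by have := Xk _ ij; rewrite coefXn eqxx rge.
rewrite block_fun_lt//; first by rewrite -size_poly_gt0; case: size ir.
by case: size ir => //= k ik; rewrite ltn_addr.
Qed.

End block_function.

(** * The spreading model *)

Lemma block_code_pattern n (p : {poly nat}) (k : 'I_n -> nat) :
  {homo k : i j / (i < j)%N} -> pattern (fun j => block_code p (k j)).
Proof.
move=> ik i j /ik; rewrite /block_code; set b := (_ + _)%N => kij.
case: ifP => kb; first by rewrite /precedes.
rewrite (_ : (k j < b)%N = false); last by lia.
by apply: locate_precedes; lia.
Qed.

(** The digits are d + 1 followed by the n gaps between the k_j, with the last digit raised by one
    to undo [pred_digits]. The leading digit must be nonzero for the degree to be n. *)
Lemma block_code_realize n d (k : 'I_n -> nat) : {homo k : i j / (i < j)%N} ->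
  (forall j, (n + d.+1 <= k j)%N) -> exists p : {poly nat},
  [/\ p != 0, head 0%N (digits p) = d.+1 &
      forall j, block_code p (k j) = (nat_of_ord j).*2.+1].
Proof.
move=> ik kn; pose ks := [seq k j | j <- enum 'I_n].
have sks : size ks = n by rewrite size_map size_enum_ord.
have ksj (j : 'I_n) : nth 0%N ks j = k j.
  by rewrite (nth_map j) ?size_enum_ord// nth_ord_enum.
have ltks : sorted ltn ks.
  rewrite sorted_map; have : sorted ltn (map val (enum 'I_n)).
    by rewrite val_enum_ord iota_ltn_sorted.
  by rewrite sorted_map; apply: sub_sorted => i j; exact: ik.
have leks : path leq (n + d.+1) ks.
  rewrite path_min_sorted; last by apply/allP => _ /mapP[j _ ->]; exact: kn.
  by apply: sub_sorted ltks => i j; exact: ltnW.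
pose e := gaps (n + d.+1) ks.
case E : (rev (d.+1 :: e)) => [|c s].
  by have := size_rev (d.+1 :: e); rewrite E.
have cs0 : last 1%N (c.+1 :: s) != 0%N.
  have : last 0%N (c :: s) = d.+1 by rewrite -E rev_cons last_rcons.
  by case: (s) => //= a s' ->.
have pE : Poly (c.+1 :: s) = c.+1 :: s :> seq nat by exact: PolyK cs0.
have dp : digits (Poly (c.+1 :: s)) = d.+1 :: e by rewrite /digits pE /= -E revK.
exists (Poly (c.+1 :: s)); split; last 1 first.
- move=> j; rewrite /block_code dp /= pE /=.
  have -> : size s = n.
    by have := size_rev (d.+1 :: e); rewrite E /= size_gaps sks => -[].
  by rewrite ltnNge kn/= -ksj locate_gaps// sks.
- by rewrite -size_poly_gt0 pE.
- by rewrite dp.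
Qed.

Lemma Cfun_sum (K : topologicalType) (K_compact : compact [set: K]) (R : realType)
    n (f : 'I_n -> Cspace K_compact R) (t : K) :
  Cfun (\sum_(i < n) f i) t = \sum_(i < n) Cfun (f i) t.
Proof. by apply: (big_morph (fun f : Cspace K_compact R => Cfun f t)). Qed.

Section coefficient_pairing.
Variable R : realType.

Definition pairing (phi : nat -> R) (u : {poly R}) : R :=
  \sum_(j < size u) u`_j * phi j.

Lemma pairingE phi (u : {poly R}) n : (size u <= n)%N ->
  pairing phi u = \sum_(j < n) u`_j * phi j.
Proof.
move=> un; rewrite /pairing (big_ord_widen n (fun j => u`_j * phi j) un).
rewrite big_mkcond/=; apply: eq_bigr => j _; case: ltnP => // ju.
by rewrite nth_default ?mul0r.
Qed.

Lemma pairingD phi u v : pairing phi (u + v) = pairing phi u + pairing phi v.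
Proof.
pose n := maxn (size u) (size v).
rewrite !(@pairingE _ _ n) ?size_polyD ?leq_maxl ?leq_maxr// -big_split/=.
by apply: eq_bigr => j _; rewrite coefD mulrDl.
Qed.

Lemma pairingZ phi a u : pairing phi (a *: u) = a * pairing phi u.
Proof.
rewrite !(@pairingE _ _ (size u)) ?size_scale_leq// mulr_sumr.
by apply: eq_bigr => j _; rewrite coefZ mulrA.
Qed.

Lemma pairingX phi n (a : 'I_n -> R) :
  pairing phi (\sum_(i < n) a i *: 'X^i) = \sum_(i < n) a i * phi i.
Proof.
have -> : pairing phi (\sum_(i < n) a i *: 'X^i) =
    \sum_(i < n) pairing phi (a i *: 'X^i).
  apply: (big_morph (pairing phi)); first exact: pairingD.
  by rewrite /pairing size_poly0 big_ord0.
apply: eq_bigr => i _; rewrite pairingZ; congr (_ * _).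
rewrite /pairing size_polyXn big_ord_recr/= coefXn eqxx mul1r big1 ?add0r// => j _.
by rewrite coefXn ltn_eqF ?mul0r.
Qed.

Variable Phi : set (nat -> R).
Hypothesis Phi0 : Phi !=set0.
Hypothesis Phi_bounded : forall u, has_ubound [set `|pairing phi u| | phi in Phi].

Definition sup_pairing (u : {poly R}) : R := sup [set `|pairing phi u| | phi in Phi].

Lemma sup_pairing_ge phi u : Phi phi -> `|pairing phi u| <= sup_pairing u.
Proof. by move=> Pphi; apply: ub_le_sup => //; exists phi. Qed.

Lemma sup_pairing_le u M :
  (forall phi, Phi phi -> `|pairing phi u| <= M) -> sup_pairing u <= M.
Proof.
move=> uM; apply: ge_sup; last by move=> _ [phi Pphi <-]; exact: uM.
by have [phi Pphi] := Phi0; exists `|pairing phi u|; exists phi.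
Qed.

Lemma sup_pairing_seminorm : is_seminorm sup_pairing.
Proof.
split=> [u v|a u].
  apply: sup_pairing_le => phi Pphi; rewrite pairingD (le_trans (ler_normD _ _))//.
  by rewrite lerD ?sup_pairing_ge.
have leZ b v : sup_pairing (b *: v) <= `|b| * sup_pairing v.
  apply: sup_pairing_le => phi Pphi; rewrite pairingZ normrM ler_wpM2l//.
  exact: sup_pairing_ge.
apply/eqP; rewrite eq_le leZ/=; have [->|a0] := eqVneq a 0.
  have [phi Pphi] := Phi0.
  by rewrite normr0 mul0r (le_trans _ (sup_pairing_ge _ Pphi)).
rewrite -ler_pdivlMl ?normr_gt0// -normfV.
by have := leZ a^-1 (a *: u); rewrite scalerA mulVf// scale1r.
Qed.

End coefficient_pairing.

Section pattern_bounded_theory.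
Variables (R : realType) (X : normedModType R) (x : nat -> X).

Lemma pattern_bounded_fill C h n (pi : 'I_n -> nat) :
  pattern_bounded x C h -> pattern pi -> pattern_bounded x C (h \o fill pi).
Proof.
move=> bh ppi m pi' a ppi'; apply: (bh m (fill pi \o pi')) => i j ij.
by apply: fill_precedes => //; exact: ppi'.
Qed.

Lemma pattern_odd n : pattern (fun j : 'I_n => (nat_of_ord j).*2.+1).
Proof. by move=> i j ij; rewrite /precedes /=; lia. Qed.

Lemma pattern_bounded_norm C h c : pattern_bounded x C h -> `|h c| <= C * `|x 0%N|.
Proof.
move=> /(_ 1%N (fun=> c) (fun=> 1)); rewrite !big_ord1 mul1r scale1r; apply.
by move=> i j; rewrite !ord1.
Qed.

Lemma pattern_bounded_const C h n (a : 'I_n -> R) : pattern_bounded x C h ->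
  `|h 0%N| * `|\sum_(j < n) a j| <= C * `|\sum_(j < n) a j *: x j|.
Proof.
by move=> /(_ n (fun=> 0%N) a); rewrite -mulr_suml normrM mulrC; apply.
Qed.

Lemma pattern_bounded_shift C h : pattern_bounded x C h ->
  pattern_bounded x (2 * C) (fun c => h c - h 0%N).
Proof.
move=> bh n pi a ppi; under eq_bigr do rewrite mulrBr.
rewrite sumrB (le_trans (ler_normB _ _))// -mulrA mulr_natl mulr2n lerD//; first exact: bh.
by rewrite -mulr_suml normrM mulrC pattern_bounded_const.
Qed.

Lemma pattern_bounded0 C : 0 <= C -> pattern_bounded x C (fun=> 0).
Proof.
by move=> C0 n pi a _; rewrite big1 ?normr0 ?mulr_ge0// => j _; rewrite mulr0.
Qed.

End pattern_bounded_theory.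

Section spreading_model.
Variables (R : realType) (X : normedModType R) (x : nat -> X) (K : R).
Hypothesis K_ge1 : 1 <= K.
Hypothesis K_spreading : forall n (k : 'I_n -> nat), {homo k : i j / (i < j)%N} ->
  forall a : 'I_n -> R,
    `|\sum_(i < n) a i *: x (k i)| <= K * `|\sum_(i < n) a i *: x i| /\
    `|\sum_(i < n) a i *: x i| <= K * `|\sum_(i < n) a i *: x (k i)|.

Let K_ge0 : 0 <= K := le_trans ler01 K_ge1.

Definition admissible (h : nat -> R) : Prop :=
  h 0%N = 0 /\ pattern_bounded x (2 * K) h.

Lemma admissible0 : admissible (fun=> 0).
Proof. by split=> //; apply: pattern_bounded0; rewrite mulr_ge0. Qed.

(** As a supremum it dominates the lost value of every norming h at once, and it inherits their
    bound on |h(0)| |sum a_j|. *)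
Definition initial_weight : R := sup [set `|h 0%N| | h in pattern_bounded x K].

Let initial_ubound : has_ubound [set `|h 0%N| | h in pattern_bounded x K].
Proof. by exists (K * `|x 0%N|) => _ [h bh <-]; exact: pattern_bounded_norm. Qed.

Lemma initial_weight_ge h : pattern_bounded x K h -> `|h 0%N| <= initial_weight.
Proof. by move=> bh; apply: ub_le_sup; [exact: initial_ubound|exists h]. Qed.

Lemma initial_weight_ge0 : 0 <= initial_weight.
Proof.
by rewrite (le_trans _ (initial_weight_ge (pattern_bounded0 _ K_ge0))).
Qed.

Lemma initial_weight_sum n (a : 'I_n -> R) :
  `|\sum_(j < n) a j * initial_weight| <= K * `|\sum_(j < n) a j *: x j|.
Proof.
rewrite -mulr_suml normrM (ger0_norm initial_weight_ge0) mulrC.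
have [->|s0] := eqVneq (\sum_(j < n) a j) 0; first by rewrite normr0 mulr0 mulr_ge0.
rewrite -ler_pdivlMr ?normr_gt0//; apply: ge_sup.
  by exists `|0 : R|; exists (fun=> 0) => //; exact: pattern_bounded0.
by move=> _ [h bh <-]; rewrite ler_pdivlMr ?normr_gt0// pattern_bounded_const.
Qed.

Definition model_functionals : set (nat -> R) :=
  [set phi | phi = (fun=> initial_weight) \/
    exists2 h, admissible h & phi = fun j => h j.*2.+1].

Lemma model_functionals0 : model_functionals !=set0.
Proof. by exists (fun=> initial_weight); left. Qed.

Lemma model_functional_le phi n (a : 'I_n -> R) : model_functionals phi ->
  `|\sum_(j < n) a j * phi j| <= 2 * K * `|\sum_(j < n) a j *: x j|.
Proof.
case=> [->|[h [_ bh] ->]]; last exact: (bh _ _ _ (@pattern_odd n)).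
by rewrite (le_trans (initial_weight_sum _))// ler_wpM2r// ler_peMl// ler1n.
Qed.

Lemma model_functionals_bounded (u : {poly R}) :
  has_ubound [set `|pairing phi u| | phi in model_functionals].
Proof.
exists (2 * K * `|\sum_(j < size u) u`_j *: x j|) => _ [phi Pphi <-].
exact: model_functional_le.
Qed.

Definition model_norm : {poly R} -> R := sup_pairing model_functionals.

Lemma model_norm_seminorm : is_seminorm model_norm.
Proof.
exact: sup_pairing_seminorm model_functionals0 model_functionals_bounded.
Qed.

Lemma model_norm_ge n (a : 'I_n -> R) phi : model_functionals phi ->
  `|\sum_(j < n) a j * phi j| <= model_norm (\sum_(j < n) a j *: 'X^j).
Proof.
by rewrite -pairingX => Pphi; apply: sup_pairing_ge => //; exact: model_functionals_bounded.
Qed.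

Lemma model_norm_le n (a : 'I_n -> R) M :
  (forall phi, model_functionals phi -> `|\sum_(j < n) a j * phi j| <= M) ->
  model_norm (\sum_(j < n) a j *: 'X^j) <= M.
Proof.
move=> aM; apply: (sup_pairing_le model_functionals0) => phi Pphi.
by rewrite pairingX; exact: aM.
Qed.

(** A norming h splits into its admissible shift h - h(0) and a constant dominated by
    [initial_weight]. Each part is at most [model_norm], whence 2K. *)
Lemma model_norm_equivalent :
  equivalent_seq model_norm (Num.norm : X -> R) (fun i => 'X^i) x.
Proof.
have K2 : 0 < 2 * K by rewrite mulr_gt0// (lt_le_trans ltr01).
exists (2 * K)^-1, (2 * K); split=> [||n a]; rewrite ?invr_gt0//; split.
  rewrite ler_pdivrMl//; apply: model_norm_le => phi; exact: model_functional_le.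
have [h [bh]] := norming_pattern K_ge1 K_spreading a.
move=> /le_trans; apply; rewrite [2 * K]mulrC -mulrA ler_wpM2l// mulr_natl mulr2n.
have -> : \sum_(j < n) a j * h (nat_of_ord j).*2.+1 =
    \sum_(j < n) a j * (h (nat_of_ord j).*2.+1 - h 0%N) + \sum_(j < n) a j * h 0%N.
  by rewrite -big_split; apply: eq_bigr => j _ /=; rewrite mulrBr subrK.
rewrite (le_trans (ler_normD _ _))// lerD//.
  apply: (@model_norm_ge _ _ (fun j => h j.*2.+1 - h 0%N)); right.
  exists (fun c => h c - h 0%N) => //; split; first by rewrite subrr.
  exact: pattern_bounded_shift.
apply: (@le_trans _ _ `|\sum_(j < n) a j * initial_weight|).
  rewrite -!mulr_suml !normrM ler_wpM2l//.
  by rewrite (ger0_norm initial_weight_ge0) initial_weight_ge.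
by apply: (@model_norm_ge _ _ (fun=> initial_weight)); left.
Qed.

Lemma model_pattern_le h n (pi : 'I_n -> nat) (a : 'I_n -> R) :
  admissible h -> pattern pi ->
  `|\sum_(j < n) a j * h (pi j)| <= model_norm (\sum_(j < n) a j *: 'X^j).
Proof.
move=> [h0 bh] ppi.
have -> : \sum_(j < n) a j * h (pi j) =
    \sum_(j < n) a j * (fun j => (h \o fill pi) j.*2.+1) j.
  by apply: eq_bigr => j _ /=; rewrite fill_odd.
apply: (@model_norm_ge n a (fun j => (h \o fill pi) j.*2.+1)); right; exists (h \o fill pi) => //; split.
  by rewrite /= fill0.
exact: pattern_bounded_fill.
Qed.

(* [(m, s)] encodes the coefficients s_j - m of a point of the grid           *)
(* {-m, ..., m}^n, so that the functionals used are indexed by integers.      *)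
Definition grid_sum (s : nat * seq nat) (h : nat -> R) : R :=
  \sum_(0 <= j < size s.2) ((nth 0%N s.2 j)%:R - s.1%:R) * h j.*2.+1.

(** The defect 1 is harmless, because grid sums are later divided by m. *)
Lemma near_norming (s : nat * seq nat) : exists h, admissible h /\
  forall h', admissible h' -> `|grid_sum s h'| <= `|grid_sum s h| + 1.
Proof.
pose A := [set `|grid_sum s h| | h in admissible].
have supA : has_sup A.
  split; first by exists `|grid_sum s (fun=> 0)|; exists (fun=> 0) => //; exact: admissible0.
  pose b j : R := (nth 0%N s.2 j)%:R - s.1%:R.
  exists (2 * K * `|\sum_(j < size s.2) b j *: x j|) => _ [h [_ bh] <-].
  rewrite /grid_sum big_mkord; exact: (bh _ _ (fun j => b j) (@pattern_odd _)).
have [_ [h ah <-] hA] := sup_adherent ltr01 supA.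
exists h; split=> // h' ah'; rewrite -lerBlDr (le_trans _ (ltW hA))// lerB//.
by apply: ub_le_sup; [case: supA|exists h'].
Qed.

(** The shift by one provides the nonzero leading digit that [block_code_realize] uses. *)
Definition near_norming_seq (d : nat) : nat -> R :=
  if d is d'.+1 then
    if unpickle d' is Some s then projT1 (cid (near_norming s)) else fun=> 0
  else fun=> 0.

Lemma near_norming_seq_admissible d : admissible (near_norming_seq d).
Proof.
case: d => [|d] /=; first exact: admissible0.
by case: unpickle => [s|]; [have [] := projT2 (cid (near_norming s))|exact: admissible0].
Qed.

Lemma near_norming_seqP s h : admissible h ->
  `|grid_sum s h| <= `|grid_sum s (near_norming_seq (pickle s).+1)| + 1.
Proof.
rewrite /= pickleK; have [_] := projT2 (cid (near_norming s)); exact.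
Qed.

Lemma grid_approx n m (a : 'I_n -> R) (h : nat -> R) (f : 'I_n -> nat) (L : R) :
  (forall c, `|h c| <= L) -> (forall j, `|m%:R * a j - ((f j)%:R - m%:R)| <= 1) ->
  `|m%:R * (\sum_(j < n) a j * h (nat_of_ord j).*2.+1) -
    grid_sum (m, [seq f j | j <- enum 'I_n]) h| <= n%:R * L.
Proof.
move=> hL fa.
have -> : grid_sum (m, [seq f j | j <- enum 'I_n]) h =
    \sum_(j < n) ((f j)%:R - m%:R) * h (nat_of_ord j).*2.+1.
  rewrite /grid_sum /= size_map size_enum_ord big_mkord; apply: eq_bigr => j _.
  by rewrite (nth_map j) ?size_enum_ord// nth_ord_enum.
rewrite mulr_sumr -sumrB (le_trans (ler_norm_sum _ _ _))//.
have -> : n%:R * L = \sum_(j < n) L by rewrite sumr_const card_ord mulr_natl.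
apply: ler_sum => j _.
by rewrite mulrA -mulrBl normrM -[leRHS]mul1r ler_pM.
Qed.

Lemma grid_point m (r : R) : -1 <= r <= 1 ->
  exists i : 'I_m.*2.+1, `|m%:R * r - (i%:R - m%:R)| <= 1.
Proof.
move=> /andP[r1 r2]; pose t := m%:R * r + m%:R.
have m0 : (0 : R) <= m%:R by [].
have t0 : 0 <= t by rewrite /t; nra.
have tm : t <= m.*2%:R by rewrite /t -addnn natrD; nra.
have /andP[tl tr] := truncn_itv t0.
have tb : (Num.truncn t < m.*2.+1)%N by rewrite ltnS -(ler_nat R) (le_trans tl).
exists (Ordinal tb) => /=; rewrite ler_norml; move: tl tr; rewrite -natr1 /t; lra.
Qed.

Definition model_seq (i : nat) : C_omega_omega R :=
  Cmk ordinal_itvWW_compact (@block_fun_continuous R near_norming_seq initial_weight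
    (fun d => (near_norming_seq_admissible d).1) i).

Lemma model_seqE n (a : 'I_n -> R) (k : 'I_n -> nat) t :
  Cfun (\sum_(j < n) a j *: model_seq (k j)) t =
  \sum_(j < n) a j * block_fun near_norming_seq initial_weight (k j) t.
Proof. by rewrite Cfun_sum. Qed.

Lemma model_seq_le n (a : 'I_n -> R) (k : 'I_n -> nat) :
  {homo k : i j / (i < j)%N} ->
  `|\sum_(j < n) a j *: model_seq (k j)| <= model_norm (\sum_(j < n) a j *: 'X^j).
Proof.
move=> ik.
have q0 : 0 <= model_norm (\sum_(j < n) a j *: 'X^j).
  by rewrite (le_trans _ (model_norm_ge a (or_introl erefl))).
apply: supnorm_le => // -[p|]; rewrite model_seqE /=; last first.
  by rewrite big1 ?normr0// => j _; rewrite mulr0.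
case: eqP => p0; first by apply: (@model_norm_ge _ _ (fun=> initial_weight)); left.
by apply: model_pattern_le (block_code_pattern _ ik); exact: near_norming_seq_admissible.
Qed.

Lemma model_seq_bounded : bounded_fun model_seq.
Proof.
exists (2 * K * `|x 0%N|); split; first exact: num_real.
move=> M /ltW KM i _ /=; apply: le_trans KM.
have := @model_seq_le 1 (fun=> 1) (fun=> i).
rewrite big_ord1 scale1r => /(_ _)/le_trans; apply; first by move=> j j'; rewrite !ord1.
apply: model_norm_le => phi Pphi.
by rewrite (le_trans (model_functional_le _ Pphi))// big_ord1 scale1r.
Qed.

Lemma model_seq_ge n (a : 'I_n -> R) (k : 'I_n -> nat) (s : nat * seq nat) :
  {homo k : i j / (i < j)%N} -> (forall j, (n + (pickle s).+1 <= k j)%N) ->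
  `|\sum_(j < n) a j * near_norming_seq (pickle s).+1 (nat_of_ord j).*2.+1| <=
  `|\sum_(j < n) a j *: model_seq (k j)|.
Proof.
move=> ik ks; have [p [p0 dp pk]] := block_code_realize ik ks.
have := ler_supnorm (\sum_(j < n) a j *: model_seq (k j)) (CNF p : ordinal_itvWW).
rewrite model_seqE /= (negPf p0) dp.
by under [X in `|X| <= _ -> _]eq_bigr do rewrite pk.
Qed.

Lemma model_seq_generates :
  generates_spreading_model model_seq model_norm (fun i => 'X^i).
Proof.
split; [exact: model_seq_bounded|exact: model_norm_seminorm|move=> n eps eps0].
pose L := 2 * K * `|x 0%N|.
have hL h c : admissible h -> `|h c| <= L by move=> [_]; exact: pattern_bounded_norm.
have L0 : 0 <= L by rewrite !mulr_ge0.
(* Rounding costs n L for h and n L for the chosen near-maximizer, whose own defect is 1. *)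
pose m := (Num.truncn ((2 * (n%:R * L) + 1) / eps)).+1.
have m_eps : 2 * (n%:R * L) + 1 < m%:R * eps.
  by rewrite -ltr_pdivrMr// truncnS_gt.
pose S (f : {ffun 'I_n -> 'I_m.*2.+1}) := (m, [seq (f j : nat) | j <- enum 'I_n]).
(* The grid is finite, so this bound allows realization in every block it calls for, uniformly in
   a. *)
exists (n + (\max_f pickle (S f)).+1)%N => k kn ik a a1.
have /choice[f fa] : forall j, exists i : 'I_m.*2.+1,
    `|m%:R * a j - (i%:R - m%:R)| <= 1 by move=> j; exact: grid_point.
pose s := S (finfun f).
have ks j : (n + (pickle s).+1 <= k j)%N.
  by rewrite (leq_trans _ (kn j))// leq_add2l ltnS (leq_bigmax (F := fun f => pickle (S f))).
have fa' j : `|m%:R * a j - ((finfun f j : nat)%:R - m%:R)| <= 1 by rewrite ffunE.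
have m0 : 0 < m%:R :> R by rewrite ltr0n.
have := model_seq_le a ik; set N := `|_| => Nq.
suff qN : model_norm (\sum_(i < n) a i *: 'X^i) <= N + (2 * (n%:R * L) + 1) / m%:R.
  rewrite ler0_norm ?subr_le0// opprB ltrBlDl (le_lt_trans qN)// ltrD2l.
  by rewrite ltr_pdivrMr// [eps * _]mulrC.
apply: model_norm_le => phi Pphi.
have [->|[h ah ->]] := Pphi.
  apply: (@le_trans _ _ N).
    have := ler_supnorm (\sum_(j < n) a j *: model_seq (k j)) (CNF 0 : ordinal_itvWW).
    by rewrite model_seqE /= eqxx.
  by rewrite lerDl divr_ge0// addr_ge0// !mulr_ge0.
have g1 := grid_approx (fun c => hL _ c ah) fa'.
have g2 := grid_approx (fun c => hL _ c (near_norming_seq_admissible (pickle s).+1)) fa'.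
have g3 := near_norming_seqP s ah.
have g4 := model_seq_ge a ik ks; rewrite -/N in g4.
rewrite -/s in g1 g2.
rewrite -(ler_pM2l m0) mulrDr [_ * (_ / _)]mulrC divfK ?gt_eqF//.
rewrite -[m%:R in leLHS](ger0_norm (ltW m0)) -normrM.
move: g1 g2 g3 g4 => /=; set u := m%:R * _; set v := grid_sum s h; set w := grid_sum s _.
set z := \sum_(j < n) _; move=> g1 g2 g3 g4.
have g5 : m%:R * `|z| <= m%:R * N by rewrite ler_wpM2l// ltW.
have e5 : `|m%:R * z| = m%:R * `|z| by rewrite normrM ger0_norm ?ltW.
have t1 : `|u| <= `|u - v| + `|v|.
  by have := ler_normD (u - v) v; rewrite subrK.
have t2 : `|w| <= `|m%:R * z - w| + `|m%:R * z|.
  by have := ler_normD (w - m%:R * z) (m%:R * z); rewrite subrK distrC.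
move: g5; rewrite -e5; lra.
Qed.

End spreading_model.

Theorem theorem8 (R : realType) (X : completeNormedModType R) (x : nat -> X) :
  schauder_basis x -> spreading x ->
  exists (y : nat -> C_omega_omega R) (E : lmodType R) (q : E -> R)
    (e : nat -> E),
    generates_spreading_model y q e /\
    equivalent_seq q (Num.norm : X -> R) e x.
Proof.
move=> _ /spreading_ord[K K_ge1 K_spreading].
exists (model_seq x K_ge1), {poly R}, (model_norm x K), (fun i => 'X^i); split.
  exact: model_seq_generates.
exact: model_norm_equivalent.
Qed.
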